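(* For each $k\in\{0,1,\dots,10\}$, there exist real twisted cubic curves $C_1^{(k)},C_2^{(k)}$ in $\mathbb{P}^3(\mathbb{C})$ that have $10$ common secant lines, exactly $k$ of which are totally real.
   Context: A twisted cubic curve in $\mathbb{P}^3(\mathbb{C})$ is a smooth rational curve of degree three in $\mathbb{P}^3(\mathbb{C})$; equivalently, it is the image of the standard twisted cubic $C_0=\{[s^3,s^2t,st^2,t^3] : [s,t]\in\mathbb{P}^1(\mathbb{C})\}$ under a projective linear transformation of $\mathbb{P}^3(\mathbb{C})$. A curve in $\mathbb{P}^3(\mathbb{C})$ (in particular a twisted cubic curve or a line) is real if it has a set of defining equations with real coefficients. A point of $\mathbb{P}^3(\mathbb{C})$ is real if it can be represented by real homogeneous coordinates. A line $\ell\subset\mathbb{P}^3(\mathbb{C})$ is a secant line of a twisted cubic $C$ if $C\cap\ell$ contains at least two distinct points (it then consists of exactly two points). A common secant line of $C_1,C_2$ is a line that is a secant line of both. For real twisted cubic curves $C_1,C_2$, a common secant line $\ell$ that is a real line is called totally real if both $C_1\cap\ell$ and $C_2\cap\ell$ consist of two real points. *)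

(* Defs.v *)
From HB Require Import structures.
From mathcomp Require Import all_boot all_order all_algebra.
From mathcomp Require Import mpoly complex.
From mathcomp Require Import boolp classical_sets functions cardinality reals.

Set Implicit Arguments.
Unset Strict Implicit.
Unset Printing Implicit Defensive.

Import Order.TTheory GRing.Theory Num.Theory.

Local Open Scope classical_set_scope.
Local Open Scope ring_scope.

(* Points (resp. lines) of P^3 over R[i] are encoded as the linear subspaces of
   dimension 1 (resp. 2) of R[i]^4, compared with Leibniz equality *)
Definition proj_point (R : realType) := {p : {vspace 'rV[R[i]]_4} | \dim p == 1%N}.
Definition proj_line (R : realType) := {l : {vspace 'rV[R[i]]_4} | \dim l == 2%N}.

Definition line_points (R : realType) (l : proj_line R) : set (proj_point R) :=
  [set p | (val p <= val l)%VS].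

Definition cubic_vector (R : realType) (s t : R[i]) : 'rV[R[i]]_4 :=
  \row_(j < 4) (s ^+ (3 - j) * t ^+ j).

Definition standard_twisted_cubic (R : realType) : set (proj_point R) :=
  [set p | exists s t : R[i],
     (s, t) != (0, 0) /\ val p = <[cubic_vector s t]>%VS].

Definition twisted_cubic (R : realType) (C : set (proj_point R)) : Prop :=
  exists2 A : 'M[R[i]]_4, A \in unitmx &
    C = [set q | exists2 p, standard_twisted_cubic p &
                   val q = (linfun (mulmxr A) @: val p)%VS].

(* The condition ranges over all vectors of the subspace p; for a homogeneous f it
   amounts to the vanishing of f at any one representative of p *)
Definition vanishes_at (R : realType) (f : {mpoly R[4]}) (p : proj_point R) : Prop :=
  forall v : 'rV[R[i]]_4, v \in val p ->
    (map_mpoly (real_complex R) f).@[fun j => v ord0 j] = 0.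

(* C is the zero set of homogeneous polynomials with real coefficients; this is
   used both for cubic curves and for lines *)
Definition real_locus (R : realType) (C : set (proj_point R)) : Prop :=
  exists2 E : set {mpoly R[4]},
    (forall f, E f -> exists d : nat, f \is d.-homog) &
    C = [set p | forall f, E f -> vanishes_at f p].

Definition real_line (R : realType) (l : proj_line R) : Prop :=
  real_locus (line_points l).

Definition real_point (R : realType) (p : proj_point R) : Prop :=
  exists w : 'rV[R]_4, val p = <[map_mx (real_complex R) w]>%VS.

Definition secant (R : realType) (C : set (proj_point R)) (l : proj_line R) : Prop :=
  exists p q : proj_point R, p != q /\ [set p; q] `<=` C `&` line_points l.

Definition common_secant (R : realType) (C1 C2 : set (proj_point R)) (l : proj_line R) :
    Prop :=
  secant C1 l /\ secant C2 l.

Definition meets_in_two_real_points (R : realType) (C : set (proj_point R))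
    (l : proj_line R) : Prop :=
  exists p q : proj_point R, [/\ p != q, real_point p, real_point q &
    C `&` line_points l = [set p; q]].

Definition totally_real (R : realType) (C1 C2 : set (proj_point R)) (l : proj_line R) :
    Prop :=
  [/\ common_secant C1 C2 l, real_line l,
      meets_in_two_real_points C1 l & meets_in_two_real_points C2 l].

(* Main.v *)
Require Import Defs.
From mathcomp Require Import all_boot all_order all_algebra.
From mathcomp Require Import finmap.
From mathcomp Require Import mpoly complex ring.
From mathcomp Require Import boolp classical_sets functions cardinality reals.

(** Two twisted cubics through three common points P1, P2, P3 show nine of their
   common secants at once. The lines joining two of the points are three of them.
   Projecting from Pi turns both cubics into conics through the images of the other
   two shared points; each of the two remaining intersections of these conics is the
   image of a common secant through Pi, which gives six more. A single common secant,
   the lonely one, avoids all three points. The pairs of cubics below are of this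
   kind, and every k is reached by choosing which of the ten lines are totally real.

   The first cubic is the standard one, and P1, P2, P3 are its points of parameters
   [1 : 0], [1 : h], [1 : - h], where h^2 = eps is 1 or -1: for eps = 1 the three
   points are real, for eps = -1 the last two are conjugate. The second cubic is the
   image of the first under a real matrix that depends on three real numbers m, n, e
   and fixes the three points. The reflection t -> - t preserves both cubics and
   exchanges P2 and P3.

   A chord of the standard cubic is the same thing as a binary quadratic form up to
   scale, whose roots are the parameters of its two points ([secantP]). The form is
   described by a triple (x, y, z), its values at the shared points up to constants,
   so that a zero entry says that the chord passes through the corresponding point.
   In these terms the common chords are found by distinguishing which entries vanish
   ([same_chord_common]):
   - two entries vanish: the line joins two shared points;
   - only x vanishes: m (1 - e) (y + z)^2 = e (1 - m) (y - z)^2, two solutions;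
   - only y vanishes: n x^2 + g x z + m z^2 = 0 with g = n + m + e - n e, two
     solutions, and likewise for z by reflection;
   - no entry vanishes: (x, y, z) is proportional to (2 m, - n, - n).

   A common secant is totally real exactly when its forms on the two cubics have only
   real roots ([totally_realP]), and this is decided by signs ([family_counts]): the
   joins require eps > 0, the two secants through P1 a sign condition involving eps, m
   and e, the four secants through P2 and P3 require eps > 0 and g^2 > 4 m n, and the
   lonely one requires the two forms it defines to be indefinite. For eps = 1 the last
   three conditions can be prescribed independently and contribute 2, 4 and 1 to the
   initial 3, so every value from 3 to 10 occurs. For eps = -1 the joins and the four
   secants never count, and 0, 1, 2 occur. Rational parameters are listed in
   [instances]. *)

Set Implicit Arguments.
Unset Strict Implicit.
Unset Printing Implicit Defensive.

Import Order.TTheory GRing.Theory Num.Theory.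

Local Open Scope classical_set_scope.
Local Open Scope card_scope.
Local Open Scope ring_scope.

(** * Common chords in coordinates adapted to the shared points *)

Section LinComb.
Variables (F : comPzRingType).
Implicit Types a b c : F.
(** Consequences of polynomial equations are certified by the coefficients of a linear
   combination of the hypotheses; what remains is an identity for ring. *)
Lemma eq_lincomb1 c1 a1 b1 a b : a1 = b1 -> a - b = c1 * (a1 - b1) -> a = b.
Proof. by move=> ->; rewrite subrr mulr0 => /subr0_eq. Qed.

Lemma eq_lincomb2 c1 c2 a1 b1 a2 b2 a b : a1 = b1 -> a2 = b2 ->
  a - b = c1 * (a1 - b1) + c2 * (a2 - b2) -> a = b.
Proof. by move=> -> ->; rewrite !subrr !mulr0 addr0 => /subr0_eq. Qed.

Lemma eq_lincomb3 c1 c2 c3 a1 b1 a2 b2 a3 b3 a b : a1 = b1 -> a2 = b2 -> a3 = b3 ->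
  a - b = c1 * (a1 - b1) + c2 * (a2 - b2) + c3 * (a3 - b3) -> a = b.
Proof. by move=> -> -> ->; rewrite !subrr !mulr0 !addr0 => /subr0_eq. Qed.
End LinComb.
Arguments eq_lincomb1 {F} c1 {a1 b1 a b}.
Arguments eq_lincomb2 {F} c1 c2 {a1 b1 a2 b2 a b}.
Arguments eq_lincomb3 {F} c1 c2 c3 {a1 b1 a2 b2 a3 b3 a b}.

Section Classification.
Variables (F : fieldType) (m n e : F).
Hypothesis two_neq0 : 2%:R != 0 :> F.

(** The chord of the first cubic attached to a triple of values at the shared points.
   The coordinates w are chosen so that the shared points lie on the first three
   axes; the link with the original coordinates is [mem_form_chord]. *)
Definition first_chord (p : F * F * F) (w1 w2 w3 w4 : F) : Prop :=
  let: (x, y, z) := p in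
  x * w1 + y * w2 + z * w3 = 0 /\ y * w2 - z * w3 + (x + y + z) * w4 = 0.

(** The chord of the second cubic, whose form is rescaled entrywise (see [weight]) so
   that its two equations differ from those of [first_chord] only in the last
   coefficient. *)
Definition second_chord (p : F * F * F) (w1 w2 w3 w4 : F) : Prop :=
  let: (x, y, z) := p in
  x * w1 + y * w2 + z * w3 + e * (y - z) * w4 = 0 /\
  y * w2 - z * w3 + ((1 - n) * x + (1 - m) * (y + z)) * w4 = 0.

Definition same_chord p q := forall w1 w2 w3 w4,
  first_chord p w1 w2 w3 w4 <-> second_chord q w1 w2 w3 w4.

(** The reflection that exchanges the second and the third shared point. *)
Lemma first_chord_swap x y z w1 w2 w3 w4 :
  first_chord (x, z, y) w1 w3 w2 (- w4) <-> first_chord (x, y, z) w1 w2 w3 w4.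
Proof.
rewrite /first_chord; split=> -[H1 H2]; split.
- by rewrite -H1; ring.
- by rewrite -[RHS]oppr0 -H2; ring.
- by rewrite -H1; ring.
- by rewrite -[RHS]oppr0 -H2; ring.
Qed.

Lemma second_chord_swap x y z w1 w2 w3 w4 :
  second_chord (x, z, y) w1 w3 w2 (- w4) <-> second_chord (x, y, z) w1 w2 w3 w4.
Proof.
rewrite /second_chord; split=> -[H1 H2]; split.
- by rewrite -H1; ring.
- by rewrite -[RHS]oppr0 -H2; ring.
- by rewrite -H1; ring.
- by rewrite -[RHS]oppr0 -H2; ring.
Qed.

Lemma same_chord_swap x y z x' y' z' :
  same_chord (x, y, z) (x', y', z') -> same_chord (x, z, y) (x', z', y').
Proof.
move=> H w1 w2 w3 w4; split=> Hw.
- by apply/second_chord_swap/H; apply/first_chord_swap.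
- by apply/first_chord_swap/H; apply/second_chord_swap.
Qed.

(** The two lines contain the same shared points, as seen on the basis vectors. *)
Lemma same_chord_zero x y z x' y' z' : same_chord (x, y, z) (x', y', z') ->
  [/\ (x == 0) = (x' == 0), (y == 0) = (y' == 0) & (z == 0) = (z' == 0)].
Proof.
move=> H; split.
- have := H 1 0 0 0; rewrite /first_chord /second_chord !(mulr1, mulr0, subr0, addr0) => -[H1 H2].
  by apply/eqP/eqP => [E|E]; [case: H1|case: H2].
- have := H 0 1 0 0; rewrite /first_chord /second_chord !(mulr1, mulr0, subr0, addr0, add0r) => -[H1 H2].
  by apply/eqP/eqP => [E|E]; [case: H1|case: H2].
- have := H 0 0 1 0; rewrite /first_chord /second_chord !(mulr1, mulr0, sub0r, addr0, add0r) => -[H1 H2].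
  by apply/eqP/eqP => [E|E]; [case: H1|case: H2] => //; rewrite E oppr0.
Qed.

(** A further point of the first chord gives two linear equations for y' and z'; they
   have a non-zero solution only if their determinant vanishes. *)
Lemma same_chord_x0 y z x' y' z' : y != 0 -> z != 0 ->
  same_chord (0, y, z) (x', y', z') ->
  m * (1 - e) * (y + z) ^+ 2 = e * (1 - m) * (y - z) ^+ 2.
Proof.
move=> y0 z0 H.
have [+ ey _] := same_chord_zero H; rewrite eqxx => /esym/eqP x'0.
have y'0 : y' != 0 by rewrite -ey.
(* A point of the first chord other than the shared one. *)
have [|E1 E2] := (H 0 (- (y + z) * z) ((y + z) * y) (2%:R * y * z)).1.
- by rewrite /first_chord; split; ring.
have nz : 2%:R * y' * y * z != 0 by rewrite !mulf_neq0.
apply: (mulfI nz).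
apply: (eq_lincomb2 (y * (2%:R * (1 - m) * z - (y + z)))
          (- (y * (y + z - 2%:R * e * z))) E1 E2).
by rewrite x'0; ring.
Qed.

Lemma same_chord_y0 x z x' y' z' : x != 0 -> z != 0 ->
  same_chord (x, 0, z) (x', y', z') ->
  n * x ^+ 2 + (n + m + e - n * e) * x * z + m * z ^+ 2 = 0.
Proof.
move=> x0 z0 H.
have [_ + ez] := same_chord_zero H; rewrite eqxx => /esym/eqP y'0.
have z'0 : z' != 0 by rewrite -ez.
(* A point of the first chord other than the shared one. *)
have [|E1 E2] := (H (- (x + z) * z) 0 ((x + z) * x) (x * z)).1.
- by rewrite /first_chord; split; ring.
have nz : x * z' != 0 by rewrite !mulf_neq0.
apply: (mulfI nz).
apply: (eq_lincomb2 (- (1 - n) * x) (- (x + z)) E1 E2).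
by rewrite y'0; ring.
Qed.

(** The point of the chord with w4 = 0 forces the two triples to be proportional. After
   that the chords agree as soon as the coefficients of w4 do, which is two linear
   conditions on the triple. *)
Lemma same_chord_xyz x y z x' y' z' : x != 0 -> y != 0 -> z != 0 -> e != 0 ->
  same_chord (x, y, z) (x', y', z') -> y = z /\ n * x + 2%:R * m * y = 0.
Proof.
move=> x0 y0 z0 e0 H.
have [_ ey _] := same_chord_zero H.
have y'0 : y' != 0 by rewrite -ey.
(* The point of the chord in the plane w4 = 0. *)
have [|E1 E2] := (H (- 2%:R * y * z) (x * z) (x * y) 0).1.
- by rewrite /first_chord; split; ring.
have two_x : 2%:R * x != 0 by rewrite mulf_neq0.
have zy' : z * y' = y * z'.
  by apply: (mulfI x0); apply: (eq_lincomb1 1 E2); ring.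
have yx' : y * x' = x * y'.
  apply: (mulfI (mulf_neq0 two_neq0 z0)).
  by apply: (eq_lincomb2 (-1) (-1) E1 E2); ring.
(* The point of the chord in the plane w3 = 0. *)
have [|E3 E4] := (H (y * (x + y + z)) (- x * (x + y + z)) 0 (x * y)).1.
- by rewrite /first_chord; split; ring.
have yz : y = z.
  have nz : e * x * y * y' != 0 by rewrite !mulf_neq0.
  apply: (mulfI nz); apply: (eq_lincomb3 y (- (y * (x + y + z)) ) (- e * x * y) E3 yx' zy').
  ring.
split=> //; have nz : - (y * y' * x) != 0 by rewrite oppr_eq0 !mulf_neq0.
apply: (mulfI nz); move: zy' E4; rewrite -yz => zy' E4.
apply: (eq_lincomb3 y (- (1 - n) * (x * y)) ((1 - m) * (x * y)) E4 yx' zy').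
by ring.
Qed.

Definition scale (k : F) (p : F * F * F) : F * F * F :=
  let: (x, y, z) := p in (k * x, k * y, k * z).

Section List.
Variables om r1 r2 : F.

(** On a chord through the first shared point, om is the ratio (y - z) / (y + z) up to
   sign; on a chord through the second, r1 and r2 are the possible ratios z / x. *)
Definition common_chords : seq (F * F * F) :=
  [:: (1, 0, 0); (0, 1, 0); (0, 0, 1);
      (0, 1 + om, 1 - om); (0, 1 - om, 1 + om);
      (1, 0, r1); (1, 0, r2); (1, r1, 0); (1, r2, 0);
      (2%:R * m, - n, - n)].

Hypotheses (m0 : m != 0) (n0 : n != 0) (e0 : e != 0) (m1 : m != 1).
Hypothesis om2 : e * (1 - m) * om ^+ 2 = m * (1 - e).
Hypothesis r_sum : m * (r1 + r2) = - (n + m + e - n * e).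
Hypothesis r_prod : m * (r1 * r2) = n.

Lemma quadratic_roots x z : x != 0 -> n * x ^+ 2 + (n + m + e - n * e) * x * z + m * z ^+ 2 = 0 ->
  z = x * r1 \/ z = x * r2.
Proof.
move=> x0 H; have: m * ((z - x * r1) * (z - x * r2)) = m * 0.
  by apply: (eq_lincomb3 1 (- x * z) (x ^+ 2) H r_sum r_prod); ring.
move/(mulfI m0)/eqP; rewrite mulf_eq0 !subr_eq0.
by case/orP => /eqP; [left|right].
Qed.

Lemma same_chord_common p q : p != (0, 0, 0) -> same_chord p q ->
  exists k p0, [/\ k != 0, p0 \in common_chords & p = scale k p0].
Proof.
case: p => [[x y] z] p0; case: q => [[x' y'] z'] H.
have := p0; rewrite !xpair_eqE.
case: (eqVneq x 0) => [x0|x0]; case: (eqVneq y 0) => [y0|y0];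
  case: (eqVneq z 0) => [z0|z0] //= _.
- exists z, (0, 0, 1); split=> //; first by rewrite !inE eqxx ?orbT.
  by rewrite /= mulr0 mulr1 x0 y0.
- exists y, (0, 1, 0); split=> //; first by rewrite !inE eqxx ?orbT.
  by rewrite /= mulr0 mulr1 x0 z0.
- rewrite x0 in H *; have E := same_chord_x0 y0 z0 H.
  have S0 : y + z != 0.
    apply: contra_neq y0 => S0; move: E; rewrite S0 expr0n mulr0 => /esym/eqP.
    rewrite !mulf_eq0 (negPf e0) subr_eq0 eq_sym (negPf m1) /= orbb => /eqP D0.
    by apply: (mulfI two_neq0); rewrite mulr0 -[RHS]addr0 -{1}S0 -D0; ring.
  have: (e * (1 - m)) * ((y - z - om * (y + z)) * (y - z + om * (y + z))) = 0.
    by apply: (eq_lincomb2 (-1) (- (y + z) ^+ 2) E om2); ring.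
  move/eqP; rewrite !mulf_eq0 (negPf e0) subr_eq0 eq_sym (negPf m1) /=.
  case/orP => /eqP D.
  + exists ((y + z) / 2%:R), (0, 1 + om, 1 - om); split; rewrite ?mulf_neq0 ?invr_neq0 //.
      by rewrite !inE eqxx ?orbT.
    rewrite /= mulr0; congr (_, _, _); apply: (mulIf two_neq0).
      by apply: (eq_lincomb1 1 D); field.
    by apply: (eq_lincomb1 (-1) D); field.
  + exists ((y + z) / 2%:R), (0, 1 - om, 1 + om); split; rewrite ?mulf_neq0 ?invr_neq0 //.
      by rewrite !inE eqxx ?orbT.
    rewrite /= mulr0; congr (_, _, _); apply: (mulIf two_neq0).
      by apply: (eq_lincomb1 1 D); field.
    by apply: (eq_lincomb1 (-1) D); field.
- exists x, (1, 0, 0); split=> //; first by rewrite !inE eqxx ?orbT.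
  by rewrite /= mulr0 mulr1 y0 z0.
- rewrite y0 in H *; case: (quadratic_roots x0 (same_chord_y0 x0 z0 H)) => ->.
  + by exists x, (1, 0, r1); rewrite /= mulr0 mulr1 !inE eqxx ?orbT.
  + by exists x, (1, 0, r2); rewrite /= mulr0 mulr1 !inE eqxx ?orbT.
- rewrite z0 in H *; case: (quadratic_roots x0 (same_chord_y0 x0 y0 (same_chord_swap H))) => ->.
  + by exists x, (1, r1, 0); rewrite /= mulr0 mulr1 !inE eqxx ?orbT.
  + by exists x, (1, r2, 0); rewrite /= mulr0 mulr1 !inE eqxx ?orbT.
- have [<- E] := same_chord_xyz x0 y0 z0 e0 H.
  exists (- y / n), (2%:R * m, - n, - n).
  rewrite mulf_neq0 ?oppr_eq0 ?invr_neq0 // !inE eqxx ?orbT; split=> //=.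
  congr (_, _, _); last 2 first.
  - by field.
  - by field.
  by apply: (mulfI n0); apply: (eq_lincomb1 1 E); field.
Qed.

(** Conversely each listed triple gives a common chord, because both equations of the
   second chord are combinations of the two equations of the first. *)
Lemma chord_join1 w1 w2 w3 w4 :
  first_chord (1, 0, 0) w1 w2 w3 w4 -> second_chord (1, 0, 0) w1 w2 w3 w4.
Proof.
rewrite /first_chord /second_chord => -[E1 E2]; split; first by apply: (eq_lincomb1 1 E1); ring.
by apply: (eq_lincomb1 (1 - n) E2); ring.
Qed.

Lemma chord_join2 w1 w2 w3 w4 :
  first_chord (0, 1, 0) w1 w2 w3 w4 -> second_chord (0, 1, 0) w1 w2 w3 w4.
Proof.
rewrite /first_chord /second_chord => -[E1 E2]; split.
  by apply: (eq_lincomb2 (1 - e) e E1 E2); ring.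
by apply: (eq_lincomb2 m (1 - m) E1 E2); ring.
Qed.

(** The triples on the two cubics differ here: the ratio (y - z) / (y + z) is o on the
   first and m / (e o) on the second. *)
Lemma chord_through1 (o : F) w1 w2 w3 w4 : e * (1 - m) * o ^+ 2 = m * (1 - e) ->
  first_chord (0, 1 + o, 1 - o) w1 w2 w3 w4 ->
  second_chord (0, e * o + m, e * o - m) w1 w2 w3 w4.
Proof.
rewrite /first_chord /second_chord => o2 -[E1 E2]; split.
  by apply: (eq_lincomb3 (e * o * (1 - m)) (m * e) (w3 - w2) E1 E2 o2); ring.
by apply: (eq_lincomb3 (m * e) ((1 - m) * e * o) (- (w2 + w3)) E1 E2 o2); ring.
Qed.

(** The ratio x / z is 1 / r on the first cubic; multiplied by 1 - n, the one on the
   second cubic is 1 / r + m. *)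
Lemma chord_through2 (r : F) w1 w2 w3 w4 :
  m * r ^+ 2 + (n + m + e - n * e) * r + n = 0 ->
  first_chord (1, 0, r) w1 w2 w3 w4 ->
  second_chord (1 + m * r, 0, (1 - n) * r) w1 w2 w3 w4.
Proof.
rewrite /first_chord /second_chord => r0 -[E1 E2]; split.
  by apply: (eq_lincomb3 (1 + m * r) (m * r + n) (- w4) E1 E2 r0); ring.
by apply: (eq_lincomb1 (1 - n) E2); ring.
Qed.

Lemma chord_join3 w1 w2 w3 w4 :
  first_chord (0, 0, 1) w1 w2 w3 w4 -> second_chord (0, 0, 1) w1 w2 w3 w4.
Proof. by move=> /first_chord_swap/chord_join2/second_chord_swap. Qed.

Lemma chord_through3 (r : F) w1 w2 w3 w4 :
  m * r ^+ 2 + (n + m + e - n * e) * r + n = 0 ->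
  first_chord (1, r, 0) w1 w2 w3 w4 ->
  second_chord (1 + m * r, (1 - n) * r, 0) w1 w2 w3 w4.
Proof. by move=> r0 /first_chord_swap/(chord_through2 r0)/second_chord_swap. Qed.

Lemma chord_lonely w1 w2 w3 w4 :
  first_chord (2%:R * m, - n, - n) w1 w2 w3 w4 -> second_chord (2%:R * m, - n, - n) w1 w2 w3 w4.
Proof.
rewrite /first_chord /second_chord => -[E1 E2]; split.
  by apply: (eq_lincomb1 1 E1); ring.
by apply: (eq_lincomb1 1 E2); ring.
Qed.

End List.
End Classification.

(** * Twisted cubics and their chords *)

Lemma sum4 (V : nmodType) (G : 'I_4 -> V) :
  \sum_(i < 4) G i = G 0 + G 1 + G 2%:R + G 3%:R.
Proof.
rewrite !big_ord_recl big_ord0 addr0 !addrA.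
by congr (G _ + G _ + G _ + G _); apply: val_inj.
Qed.

Lemma ord4_ind (P : 'I_4 -> Prop) : P 0 -> P 1 -> P 2%:R -> P 3%:R -> forall i, P i.
Proof.
move=> P0 P1 P2 P3 [[|[|[|[|i]]]] Hi] //.
- by rewrite (_ : Ordinal _ = 0) //; apply: val_inj.
- by rewrite (_ : Ordinal _ = 1) //; apply: val_inj.
- by rewrite (_ : Ordinal _ = 2%:R) //; apply: val_inj.
- by rewrite (_ : Ordinal _ = 3%:R) //; apply: val_inj.
Qed.

Section Chords.
Variable R : realType.
Local Notation K := R[i].
Local Notation cubic := (@cubic_vector R).
Local Notation act A := (linfun (mulmxr A)).

Lemma cubicE s t : [/\ cubic s t 0 0 = s ^+ 3, cubic s t 0 1 = s ^+ 2 * t,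
  cubic s t 0 2%:R = s * t ^+ 2 & cubic s t 0 3%:R = t ^+ 3].
Proof. by split; rewrite mxE /= ?mulr1 ?mul1r ?expr1. Qed.

Lemma cubicZ k s t : cubic (k * s) (k * t) = k ^+ 3 *: cubic s t.
Proof.
have [a0 a1 a2 a3] := cubicE (k * s) (k * t); have [b0 b1 b2 b3] := cubicE s t.
apply/rowP; elim/ord4_ind; rewrite [RHS]mxE ?a0 ?a1 ?a2 ?a3 ?b0 ?b1 ?b2 ?b3; ring.
Qed.

Lemma cubic_indep k s1 t1 s2 t2 : s1 * t2 != s2 * t1 ->
  cubic s1 t1 <> k *: cubic s2 t2.
Proof.
move=> D E; have [a0 a1 a2 a3] := cubicE s1 t1; have [b0 b1 b2 b3] := cubicE s2 t2.
have coord j : cubic s1 t1 0 j = k * cubic s2 t2 0 j by rewrite E mxE.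
have := coord 3%:R; have := coord 2%:R; have := coord 1; have := coord 0.
rewrite a0 a1 a2 a3 b0 b1 b2 b3 => E0 E1 E2 E3.
have D0 : s1 * t2 - s2 * t1 != 0 by rewrite subr_eq0.
have s0 : s1 = 0.
  apply/eqP; rewrite -sqrf_eq0; apply/eqP/(mulfI D0).
  by apply: (eq_lincomb2 t2 (- s2) E0 E1); ring.
have t0 : t1 = 0.
  apply/eqP; rewrite -sqrf_eq0; apply/eqP/(mulfI D0).
  by apply: (eq_lincomb2 t2 (- s2) E2 E3); ring.
by rewrite s0 t0 mulr0 mul0r eqxx in D.
Qed.

Lemma cubic_neq0 s t : (s, t) != (0, 0) -> cubic s t != 0.
Proof.
move=> st0; apply/eqP => E; have [a0 _ _ a3] := cubicE s t.
move/eqP: st0; apply; move/eqP: a0; move/eqP: a3.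
by rewrite E !mxE ![0 == _]eq_sym !expf_eq0 /= => /eqP-> /eqP->.
Qed.

Definition chord_mx (a b c : K) : 'M[K]_(4, 2) :=
  \matrix_(i, j) if (j <= i)%N then [:: a; b; c]`_(i - j) else 0.

(** For the binary form q = a s^2 + b s t + c t^2, the line of P^3 on which the linear
   forms corresponding to the binary cubics s q and t q vanish. It joins the points of
   the standard cubic whose parameters are the roots of q. *)
Definition chord (a b c : K) : {vspace 'rV[K]_4} := lker (act (chord_mx a b c)).

Lemma chord_mxE a b c (v : 'rV[K]_4) (u := v *m chord_mx a b c) :
  u 0 0 = a * v 0 0 + b * v 0 1 + c * v 0 2%:R /\
  u 0 1 = a * v 0 1 + b * v 0 2%:R + c * v 0 3%:R.
Proof. by split; rewrite mxE sum4 !mxE /=; ring. Qed.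

Lemma mem_chord a b c (v : 'rV[K]_4) :
  v \in chord a b c <->
  a * v 0 0 + b * v 0 1 + c * v 0 2%:R = 0 /\
  a * v 0 1 + b * v 0 2%:R + c * v 0 3%:R = 0.
Proof.
have [E0 E1] := chord_mxE a b c v.
rewrite memv_ker lfunE /= -E0 -E1; split=> [/eqP->|[H0 H1]]; first by rewrite !mxE.
apply/eqP/rowP => -[[|[|i]] Hi] //.
  by rewrite (_ : Ordinal Hi = 0) ?H0 ?mxE //; apply: val_inj.
by rewrite (_ : Ordinal Hi = 1) ?H1 ?mxE //; apply: val_inj.
Qed.

(** The two equations are independent: they can be solved for any right-hand sides. *)
Lemma dim_chord (a b c : K) : (a, b, c) != (0, 0, 0) -> \dim (chord a b c) = 2%N.
Proof.
move=> abc; have := limg_ker_dim (act (chord_mx a b c) : 'Hom('rV[K]_4, 'rV[K]_2)) fullv.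
rewrite capfv -/(chord a b c) (_ : limg _ = fullv).
  rewrite !dimvf /dim /= !mul1n => H.
  by apply/eqP; rewrite -(eqn_add2r 2) H.
apply/eqP; rewrite eqEsubv subvf; apply/subvP => u _.
apply/memv_imgP.
suff [v vE] : exists v, v *m chord_mx a b c = u by exists v; rewrite ?memvf // lfunE /= vE.
suff [v [v0 v1]] : exists v : 'rV[K]_4, a * v 0 0 + b * v 0 1 + c * v 0 2%:R = u 0 0 /\
    a * v 0 1 + b * v 0 2%:R + c * v 0 3%:R = u 0 1.
  exists v; have [E0 E1] := chord_mxE a b c v; apply/rowP => -[[|[|i]] Hi] //.
    by rewrite (_ : Ordinal Hi = 0) ?E0 //; apply: val_inj.
  by rewrite (_ : Ordinal Hi = 1) ?E1 //; apply: val_inj.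
pose w (p q r s : K) : 'rV[K]_4 := \row_j [:: p; q; r; s]`_j.
have [a0|a0] := eqVneq a 0; last first.
  exists (w ((u 0 0 - b * (u 0 1 / a)) / a) (u 0 1 / a) 0 0).
  by rewrite !mxE /=; split; field.
have [c0|c0] := eqVneq c 0; last first.
  exists (w 0 0 (u 0 0 / c) ((u 0 1 - b * (u 0 0 / c)) / c)).
  by rewrite !mxE /=; split; field.
have [b0|b0] := eqVneq b 0; last first.
  exists (w 0 (u 0 0 / b) (u 0 1 / b) 0).
  by rewrite !mxE /= a0 c0; split; field.
by rewrite a0 b0 c0 eqxx in abc.
Qed.

Lemma disc_neq0 (a b c : K) : b ^+ 2 != 4%:R * a * c -> (a, b, c) != (0, 0, 0).
Proof. by apply: contra_neq => -[-> -> ->]; ring. Qed.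

(** Roots are kept homogeneous since one of them may lie at infinity. *)
Lemma form_factor (a b c : K) : exists s1 t1 s2 t2,
  [/\ a = t1 * t2, b = - (s1 * t2 + s2 * t1) & c = s1 * s2].
Proof.
have [->|c0] := eqVneq c 0.
  by exists 0, 1, (- b), a; split; ring.
pose d := sqrtC (b ^+ 2 - 4%:R * a * c).
have dE : d ^+ 2 = b ^+ 2 - 4%:R * a * c by rewrite sqrtCK.
have two0 : 2%:R != 0 :> K by rewrite pnatr_eq0.
exists c, ((- b + d) / 2%:R), 1, ((- b - d) / (2%:R * c)); split; last by ring.
- apply: (mulfI (mulf_neq0 (mulf_neq0 two0 two0) c0)).
  by apply: (eq_lincomb1 1 dE); field.
- by field.
Qed.

Lemma disc_factor (a b c : K) : b ^+ 2 != 4%:R * a * c -> exists s1 t1 s2 t2,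
  [/\ a = t1 * t2, b = - (s1 * t2 + s2 * t1), c = s1 * s2 & s1 * t2 != s2 * t1].
Proof.
move=> disc; have [s1 [t1 [s2 [t2 [aE bE cE]]]]] := form_factor a b c.
exists s1, t1, s2, t2; split=> //; apply: contra_neq disc => D.
by rewrite aE bE cE D; apply: (eq_lincomb1 (-4%:R * s2 * t1) D); ring.
Qed.

Lemma params_neq0 (s1 t1 s2 t2 : K) : s1 * t2 != s2 * t1 ->
  (s1, t1) != (0, 0) /\ (s2, t2) != (0, 0).
Proof. by move=> D; split; apply: contra_neq D => -[-> ->]; ring. Qed.

Lemma dim_pair (u v : 'rV[K]_4) : u != 0 -> v \notin <[u]>%VS ->
  \dim (<[u]> + <[v]>)%VS = 2%N.
Proof.
move=> u0 vu; rewrite addvC.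
have : free [:: v; u] by rewrite free_cons span_seq1 vu seq1_free.
by rewrite /free span_cons span_seq1 => /eqP.
Qed.

Lemma chord_span s1 t1 s2 t2 : s1 * t2 != s2 * t1 ->
  chord (t1 * t2) (- (s1 * t2 + s2 * t1)) (s1 * s2) =
    (<[cubic s1 t1]> + <[cubic s2 t2]>)%VS.
Proof.
move=> D; have D0 : s1 * t2 - s2 * t1 != 0 by rewrite subr_eq0.
apply/esym/eqP; rewrite eqEdim dim_chord; last first.
  apply: disc_neq0; rewrite -subr_eq0.
  rewrite (_ : _ - _ = (s1 * t2 - s2 * t1) ^+ 2); last by ring.
  by rewrite expf_neq0.
rewrite dim_pair.
- rewrite andbT subv_add -!memvE; apply/andP; split; apply/mem_chord.
    by have [-> -> -> ->] := cubicE s1 t1; split; ring.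
  by have [-> -> -> ->] := cubicE s2 t2; split; ring.
- apply: cubic_neq0; apply: contra_neq D => -[-> ->]; ring.
- apply/vlineP => -[k]; apply: cubic_indep; apply: contra_neq D => ->; ring.
Qed.

Definition point_space (p : proj_point R) : {vspace 'rV[K]_4} := sval p.
Definition line_space (l : proj_line R) : {vspace 'rV[K]_4} := sval l.

Lemma point_space_inj : injective point_space. Proof. exact: val_inj. Qed.
Lemma line_space_inj : injective line_space. Proof. exact: val_inj. Qed.
Lemma dim_point_space p : \dim (point_space p) = 1%N. Proof. exact/eqP/(valP p). Qed.
Lemma dim_line_space l : \dim (line_space l) = 2%N. Proof. exact/eqP/(valP l). Qed.

Lemma point_of_vec (v : 'rV[K]_4) : v != 0 -> exists p : proj_point R, point_space p = <[v]>%VS.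
Proof.
move=> v0; have Hv : \dim <[v]> == 1%N by rewrite dim_vline v0.
by exists (exist (fun U : {vspace 'rV[K]_4} => \dim U == 1%N) <[v]>%VS Hv).
Qed.

Lemma vec_of_point (p : proj_point R) : exists2 v, v != 0 & point_space p = <[v]>%VS.
Proof.
move: (point_space p) (dim_point_space p) => U dU; have U0 : U != 0%VS by rewrite -dimv_eq0 dU.
exists (vpick U); first by rewrite vpick0.
by apply/eqP; rewrite eq_sym eqEdim -memvE memv_pick dU dim_vline vpick0 U0.
Qed.

Lemma dim_point_add (p q : proj_point R) : p != q -> \dim (point_space p + point_space q)%VS = 2%N.
Proof.
have [u u0 pE] := vec_of_point p; have [v v0 qE] := vec_of_point q.
move=> pq; rewrite pE qE; apply: dim_pair => //.
apply: contra pq; rewrite memvE => vu; apply/eqP/point_space_inj; rewrite pE qE.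
by apply/esym/eqP; rewrite eqEdim vu !dim_vline u0 v0.
Qed.

Definition curve (A : 'M[K]_4) : set (proj_point R) :=
  [set q | exists2 p, standard_twisted_cubic p & point_space q = (act A @: point_space p)%VS].

Lemma curveP A q : curve A q <->
  exists s t, (s, t) != (0, 0) /\ point_space q = <[cubic s t *m A]>%VS.
Proof.
split=> [[p [s [t [st0 pE]]] ->]|[s [t [st0 qE]]]].
  have {}pE : point_space p = _ := pE; by exists s, t; split=> //; rewrite pE limg_line lfunE.
have [p pE] := point_of_vec (cubic_neq0 st0).
by exists p; [exists s, t|rewrite qE pE limg_line lfunE].
Qed.

Lemma line_cubicZ (A : 'M[K]_4) k s t : k != 0 ->
  <[cubic (k * s) (k * t) *m A]>%VS = <[cubic s t *m A]>%VS.
Proof.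
move=> k0; rewrite cubicZ -scalemxAl; apply/eqP; rewrite eqEdim !dim_vline.
rewrite -memvE scaler_eq0 expf_eq0 (negPf k0) /= leqnn andbT.
by rewrite memvZ // memv_line.
Qed.

Lemma proportional_params (s1 t1 s2 t2 : K) : (s1, t1) != (0, 0) -> (s2, t2) != (0, 0) ->
  s1 * t2 = s2 * t1 -> exists2 k, k != 0 & s2 = k * s1 /\ t2 = k * t1.
Proof.
move=> st1 st2 D; have [s0|s0] := eqVneq s1 0.
  have t0 : t1 != 0 by apply: contra_neq st1 => ->; rewrite s0.
  have s20 : s2 = 0 by apply: (mulIf t0); rewrite -D s0 !mul0r.
  exists (t2 / t1); last by rewrite s0 s20 mulr0 divfK.
  by rewrite mulf_neq0 ?invr_neq0 //; apply: contra_neq st2 => ->; rewrite s20.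
exists (s2 / s1); last first.
  split; first by rewrite divfK.
  by apply: (mulfI s0); rewrite D; field.
rewrite mulf_neq0 ?invr_neq0 //; apply: contra_neq st2 => s20.
by rewrite s20; congr (_, _); apply: (mulfI s0); rewrite D s20 mul0r mulr0.
Qed.

Section Curve.
Variable A : 'M[K]_4.
Hypothesis A_unit : A \in unitmx.

Lemma mem_act (U : {vspace 'rV[K]_4}) (v : 'rV[K]_4) :
  (v *m A \in act A @: U)%VS = (v \in U).
Proof.
apply/memv_imgP/idP => [[u uU]|vU]; last by exists v; rewrite ?lfunE.
by rewrite lfunE => /(can_inj (mulmxK A_unit)) ->.
Qed.

Lemma dim_act (U : {vspace 'rV[K]_4}) : \dim (act A @: U) = \dim U.
Proof.
apply: limg_dim_eq; apply/eqP; rewrite -subv0; apply/subvP => v.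
rewrite memv_cap memv_ker lfunE /= => /andP[_ /eqP vA].
rewrite memv0; apply/eqP/(can_inj (mulmxK A_unit)); by rewrite mul0mx.
Qed.

Lemma cubic_act_neq0 s t : (s, t) != (0, 0) -> cubic s t *m A != 0.
Proof.
move=> /cubic_neq0; apply: contra_neq => E.
by apply: (can_inj (mulmxK A_unit)); rewrite E mul0mx.
Qed.

(** At the point of parameter (s, t) the two equations of the chord are s q(s, t) and
   t q(s, t). *)
Lemma root_on_chord a b c s t :
  (<[cubic s t *m A]> <= act A @: chord a b c)%VS <->
  a * s ^+ 2 + b * s * t + c * t ^+ 2 = 0 \/ (s, t) = (0, 0).
Proof.
rewrite -memvE mem_act mem_chord; have [-> -> -> ->] := cubicE s t.
have -> : a * s ^+ 3 + b * (s ^+ 2 * t) + c * (s * t ^+ 2) =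
  s * (a * s ^+ 2 + b * s * t + c * t ^+ 2) by ring.
have -> : a * (s ^+ 2 * t) + b * (s * t ^+ 2) + c * t ^+ 3 =
  t * (a * s ^+ 2 + b * s * t + c * t ^+ 2) by ring.
split=> [[/eqP + /eqP]|[->|[-> ->]]]; last 2 first.
- by rewrite !mulr0.
- by rewrite !mul0r.
rewrite !mulf_eq0; have [->|_] := eqVneq s 0; last by move=> /= /eqP; left.
by have [->|_] := eqVneq t 0; [right|move=> _ /= /eqP; left].
Qed.

(** This replaces a pair of distinct points on the curve by one quadratic form of
   non-zero discriminant. *)
Lemma secantP (l : proj_line R) : secant (curve A) l <->
  exists a b c, b ^+ 2 != 4%:R * a * c /\ line_space l = (act A @: chord a b c)%VS.
Proof.
split.
  move=> [p [q [pq pqCl]]].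
  have [/curveP[s1 [t1 [st1 pE]]] pl0] := pqCl p (or_introl erefl).
  have pl : (point_space p <= line_space l)%VS := pl0.
  have [/curveP[s2 [t2 [st2 qE]]] ql0] := pqCl q (or_intror erefl).
  have ql : (point_space q <= line_space l)%VS := ql0.
  have D : s1 * t2 != s2 * t1.
    apply: contra_neq pq => /(proportional_params st1 st2)[k k0 [sE tE]].
    by apply: point_space_inj; rewrite pE qE sE tE line_cubicZ.
  exists (t1 * t2), (- (s1 * t2 + s2 * t1)), (s1 * s2); split.
    rewrite -subr_eq0 (_ : _ - _ = (s1 * t2 - s2 * t1) ^+ 2); last by ring.
    by rewrite expf_neq0 // subr_eq0.
  rewrite chord_span // limgD !limg_line !lfunE /= -pE -qE.
  apply/esym/eqP; rewrite eqEdim subv_add pl ql dim_point_add //=.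
  by rewrite dim_line_space.
move=> [a [b [c [disc lE]]]].
have [s1 [t1 [s2 [t2 [aE bE cE D]]]]] := disc_factor disc.
have [st1 st2] := params_neq0 D.
have [p pE] := point_of_vec (cubic_act_neq0 st1).
have [q qE] := point_of_vec (cubic_act_neq0 st2).
exists p, q; split.
  apply/eqP => pq; have : cubic s1 t1 *m A \in <[cubic s2 t2 *m A]>%VS.
    by rewrite -qE -pq pE memv_line.
  move/vlineP => [k]; rewrite scalemxAl => /(can_inj (mulmxK A_unit)).
  exact: cubic_indep.
have root_l s t (x : proj_point R) : point_space x = <[cubic s t *m A]>%VS ->
    a * s ^+ 2 + b * s * t + c * t ^+ 2 = 0 -> line_points l x.
  move=> xE root; suff: (point_space x <= line_space l)%VS by [].
  by rewrite lE xE; apply/root_on_chord; left.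
move=> x [->|->]; split.
- by apply/curveP; exists s1, t1.
- by apply: (root_l s1 t1) => //; rewrite aE bE cE; ring.
- by apply/curveP; exists s2, t2.
- by apply: (root_l s2 t2) => //; rewrite aE bE cE; ring.
Qed.

End Curve.
End Chords.

(** * Real points, real equations and totally real secants *)

Section Real.
Variable R : realType.
Local Notation K := R[i].
Local Notation cubic := (@cubic_vector R).
Local Notation act A := (linfun (mulmxr A)).
Local Notation toC := (real_complex R).
Local Notation point_space := (@point_space R).
Local Notation line_space := (@line_space R).

(** Reality of the point [s : t] of the projective line. *)
Definition real_param (s t : K) := s^* * t \is Num.real.

Lemma toC_real (r : R) : toC r \is Num.real.
Proof. by apply/complex_realP; exists r. Qed.

Lemma real_paramP s t : real_param s t -> exists k r r', s = k * toC r /\ t = k * toC r'.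
Proof.
have [->|s0] := eqVneq s 0.
  by exists t, 0, 1; rewrite rmorph0 rmorph1 mulr0 mulr1.
rewrite /real_param => st.
have : t / s \is Num.real.
  rewrite (_ : t / s = (s^* * t) / (s * s^*)); last by field; rewrite ?conjC_eq0 ?s0.
  by rewrite -normCK realM // realV rpredX // normr_real.
move/complex_realP => [r' E]; exists s, 1, r'.
by rewrite rmorph1 mulr1 -E mulrC divfK.
Qed.

Lemma real_param_real k r r' : real_param (k * toC r) (k * toC r').
Proof.
rewrite /real_param rmorphM /= (CrealP (toC_real r)).
have -> : k^* * toC r * (k * toC r') = (k * k^*) * (toC r * toC r') by ring.
by rewrite -normCK !rpredM ?rpredX ?normr_real ?toC_real.
Qed.

Lemma real_paramE s t : s != 0 -> real_param s t = (t / s \is Num.real).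
Proof.
move=> s0; apply/idP/idP => [/real_paramP[k [r [r' [sE tE]]]]|/complex_realP[r tE]].
  have k0 : k != 0 by apply: contra_neq s0; rewrite sE => ->; rewrite mul0r.
  have r0 : toC r != 0 by apply: contra_neq s0; rewrite sE => ->; rewrite mulr0.
  rewrite sE tE (_ : _ / _ = toC r' / toC r); last by field; rewrite r0 k0.
  by rewrite rpred_div ?toC_real.
have := real_param_real s 1 r; rewrite (rmorph1 toC) mulr1 -[toC r]tE.
by rewrite mulrCA divff // mulr1.
Qed.

Lemma real_param_reals s t : s \is Num.real -> t \is Num.real -> real_param s t.
Proof. by move=> sR tR; rewrite /real_param (CrealP sR) rpredM. Qed.

Lemma real_sqrt (x : R) (z : K) : z ^+ 2 = toC x -> x != 0 -> (z \is Num.real) = (0 < x).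
Proof.
move=> zE x0; apply/idP/idP => [/complex_realP[r rE]|xpos].
  have xE : x = r ^+ 2 by apply: (@complexI R); rewrite -zE rE -(rmorphXn toC).
  by rewrite lt_def x0 xE sqr_ge0.
have : z ^+ 2 == toC (Num.sqrt x) ^+ 2.
  by rewrite zE -(rmorphXn toC) /= sqr_sqrtr // ltW.
by rewrite eqf_sqr => /orP[] /eqP ->; rewrite ?rpredN toC_real.
Qed.

Definition real_rooted (a b c : K) := forall s t : K,
  a * s ^+ 2 + b * s * t + c * t ^+ 2 = 0 -> real_param s t.

Lemma real_param0 s t : (s, t) = (0, 0) -> real_param s t.
Proof. by case=> -> ->; rewrite /real_param mulr0. Qed.

Lemma real_rooted_factor s1 t1 s2 t2 : (s1, t1) != (0, 0) -> (s2, t2) != (0, 0) ->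
  real_rooted (t1 * t2) (- (s1 * t2 + s2 * t1)) (s1 * s2) <->
  real_param s1 t1 /\ real_param s2 t2.
Proof.
move=> st1 st2; split=> [rr|[/real_paramP[k1 [r1 [r1' [s1E t1E]]]]
                            /real_paramP[k2 [r2 [r2' [s2E t2E]]]]] s t].
  by split; apply: rr; ring.
have [/real_param0//|st0] := eqVneq (s, t) (0, 0).
rewrite (_ : _ + _ = (s * t1 - s1 * t) * (s * t2 - s2 * t)); last by ring.
move/eqP; rewrite mulf_eq0 !subr_eq0 => /orP[/eqP D|/eqP D].
  have [|k k0 [-> ->]] := proportional_params st1 st0 (esym _).
    by rewrite D.
  by rewrite s1E t1E !mulrA; apply: real_param_real.
have [|k k0 [-> ->]] := proportional_params st2 st0 (esym _).
  by rewrite D.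
by rewrite s2E t2E !mulrA; apply: real_param_real.
Qed.

Section Curve.
Variable A0 : 'M[R]_4.
Hypothesis A0_unit : A0 \in unitmx.
Let A := map_mx toC A0.

Let A_unit : A \in unitmx. Proof. by rewrite map_unitmx. Qed.

(** After removing the real matrix, a real point of the standard cubic has a real
   quotient s^2 t / s^3. *)
Lemma real_pointP s t (p : proj_point R) : (s, t) != (0, 0) ->
  point_space p = <[cubic s t *m A]>%VS -> real_point p <-> real_param s t.
Proof.
move=> st0 pE; split.
  move=> [w wE]; have {}wE : point_space p = <[map_mx toC w]>%VS := wE.
  have : cubic s t *m A \in <[map_mx toC w]>%VS by rewrite -wE pE memv_line.
  move=> /vlineP[k].
  rewrite -[map_mx toC w](mulmxKV A_unit) -map_invmx -map_mxM scalemxAl.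
  move=> /(can_inj (mulmxK A_unit)) E.
  set u := w *m _ in E.
  have coord j : cubic s t 0 j = k * toC (u 0 j) by rewrite E !mxE.
  have [c0 c1 _ _] := cubicE s t.
  rewrite /real_param; have [->|s0] := eqVneq s 0; first by rewrite conjC0 mul0r.
  have s3 : k * toC (u 0 0) != 0 by rewrite -coord c0 expf_neq0.
  have -> : s^* * t = (s * s^*) * (toC (u 0 1) / toC (u 0 0)).
    have : t / s = k * toC (u 0 1) / (k * toC (u 0 0)).
      by rewrite -!coord c0 c1; field.
    move=> tE; move: s3; rewrite mulf_eq0 negb_or => /andP[k0 u0].
    rewrite (_ : toC _ / _ = k * toC (u 0 1) / (k * toC (u 0 0))); last by field; rewrite u0.
    by rewrite -tE; field.
  by rewrite -normCK !rpredM ?rpredX ?realV ?normr_real ?toC_real.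
move=> /real_paramP[k [r [r' [sE tE]]]].
have k0 : k != 0 by apply: contra_neq st0; rewrite sE tE => ->; rewrite !mul0r.
pose w : 'rV[R]_4 := \row_(j < 4) (r ^+ (3 - j) * r' ^+ j).
exists (w *m A0); rewrite -[LHS]/(point_space p) pE sE tE line_cubicZ // map_mxM.
congr (<[_ *m _]>%VS); apply/rowP => j.
by rewrite !mxE rmorphM !rmorphXn.
Qed.

(** A chord has no third point on the cubic, so its two points are the roots of its
   form. *)
Lemma meets_in_two_real_pointsP a b c (l : proj_line R) : b ^+ 2 != 4%:R * a * c ->
  line_space l = (act A @: chord a b c)%VS ->
  meets_in_two_real_points (curve A) l <-> real_rooted a b c.
Proof.
move=> disc lE.
have memP s t (x : proj_point R) : (s, t) != (0, 0) -> point_space x = <[cubic s t *m A]>%VS ->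
    line_points l x <-> a * s ^+ 2 + b * s * t + c * t ^+ 2 = 0.
  move=> st0 xE; change ((point_space x <= line_space l)%VS <-> a * s ^+ 2 + b * s * t + c * t ^+ 2 = 0).
  rewrite lE xE (root_on_chord A_unit); split; last by left.
  by case=> // E; rewrite E eqxx in st0.
split.
  move=> [p [q [pq pR qR E]]] s t root.
  have [/real_param0//|st0] := eqVneq (s, t) (0, 0).
  have [x xE] := point_of_vec (cubic_act_neq0 A_unit st0).
  suff: real_point x by move/(real_pointP st0 xE).
  have : (curve A `&` line_points l) x.
    by split; [apply/curveP; exists s, t|apply/(memP s t)].
  by rewrite E => -[->|->].
move=> rr.
have [s1 [t1 [s2 [t2 [aE bE cE D]]]]] := disc_factor disc.
have [st1 st2] := params_neq0 D.
move: rr; rewrite aE bE cE => /(real_rooted_factor st1 st2)[real1 real2].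
have [p pE] := point_of_vec (cubic_act_neq0 A_unit st1).
have [q qE] := point_of_vec (cubic_act_neq0 A_unit st2).
exists p, q; split.
- apply/eqP => pq; have : cubic s1 t1 *m A \in <[cubic s2 t2 *m A]>%VS.
    by rewrite -qE -pq pE memv_line.
  move/vlineP => [k]; rewrite scalemxAl => /(can_inj (mulmxK A_unit)).
  exact: cubic_indep.
- exact/(real_pointP st1 pE).
- exact/(real_pointP st2 qE).
apply/seteqP; split=> x.
  move=> [/curveP[s [t [st0 xE]]] /(memP s t x st0 xE)].
  rewrite aE bE cE (_ : _ + _ = (s * t1 - s1 * t) * (s * t2 - s2 * t)); last by ring.
  move/eqP; rewrite mulf_eq0 !subr_eq0 => /orP[/eqP D1|/eqP D2]; [left|right].
    have [|k k0 [sE tE]] := proportional_params st1 st0 (esym _); first by rewrite D1.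
    by apply: point_space_inj; rewrite xE pE sE tE line_cubicZ.
  have [|k k0 [sE tE]] := proportional_params st2 st0 (esym _); first by rewrite D2.
  by apply: point_space_inj; rewrite xE qE sE tE line_cubicZ.
move=> [->|->]; split.
- by apply/curveP; exists s1, t1.
- by apply/(memP s1 t1) => //; rewrite aE bE cE; ring.
- by apply/curveP; exists s2, t2.
- by apply/(memP s2 t2) => //; rewrite aE bE cE; ring.
Qed.

(** The linear forms giving the coordinates of v A^-1. *)
Definition pull_coord (j : 'I_4) : {mpoly R[4]} := \sum_(k < 4) invmx A0 k j *: 'X_k.

Lemma pull_coord_homog j : pull_coord j \is 1.-homog.
Proof. by apply: rpred_sum => k _; apply: dhomogZ; rewrite dhomogX /= mdeg1. Qed.

Lemma pull_coordE j (u : 'rV[K]_4) :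
  (map_mpoly toC (pull_coord j)).@[fun k => (u *m A) 0 k] = u 0 j.
Proof.
rewrite /pull_coord (raddf_sum (map_mpoly toC)) (raddf_sum (meval _)).
rewrite -[u in RHS](mulmxK A_unit) -map_invmx [RHS]mxE.
by apply: eq_bigr => k _; rewrite /= map_mpolyZ map_mpolyX mevalZ mevalXU mulrC !mxE.
Qed.

Definition pull_minor i j k l : {mpoly R[4]} :=
  pull_coord i * pull_coord j - pull_coord k * pull_coord l.

Lemma pull_minor_homog i j k l : pull_minor i j k l \is 2.-homog.
Proof.
have mulh a b := dhomogM (pull_coord_homog a) (pull_coord_homog b).
exact: rpredB (mulh i j) (mulh k l).
Qed.

Lemma eval_minor (p q r t : {mpoly R[4]}) (v : 'I_4 -> K) :
  (map_mpoly toC (p * q - r * t)).@[v] =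
  (map_mpoly toC p).@[v] * (map_mpoly toC q).@[v] -
  (map_mpoly toC r).@[v] * (map_mpoly toC t).@[v].
Proof.
rewrite (rmorphB (map_mpoly toC)) mevalB /=; congr (_ - _).
  have -> : map_mpoly toC (p * q) = map_mpoly toC p * map_mpoly toC q.
    exact: (rmorphM (map_mpoly toC)).
  exact: mevalM.
have -> : map_mpoly toC (r * t) = map_mpoly toC r * map_mpoly toC t.
  exact: (rmorphM (map_mpoly toC)).
exact: mevalM.
Qed.

Lemma pull_minorE i j k l (u : 'rV[K]_4) :
  (map_mpoly toC (pull_minor i j k l)).@[fun h => (u *m A) 0 h] =
  u 0 i * u 0 j - u 0 k * u 0 l.
Proof.
by rewrite /pull_minor (eval_minor (pull_coord i));
  congr (_ * _ - _ * _); apply: pull_coordE.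
Qed.

(** The standard cubic is cut out by the 2 by 2 minors of the matrix with rows
   (x0, x1, x2) and (x1, x2, x3); a real matrix transports them to real equations. *)
Lemma real_locus_curve : real_locus (curve A).
Proof.
exists [set f | [\/ f = pull_minor 0 2%:R 1 1, f = pull_minor 1 3%:R 2%:R 2%:R |
                    f = pull_minor 0 3%:R 1 2%:R]].
  by move=> f [] ->; exists 2; apply: pull_minor_homog.
apply/seteqP; split=> p.
  move=> /curveP[s [t [st0 pE]]] f Ef v vp.
  have {}vp : v \in point_space p := vp; move: vp; rewrite pE => /vlineP[k].
  rewrite scalemxAl => ->; have [c0 c1 c2 c3] := cubicE s t.
  have coord j : (k *: cubic s t) 0 j = k * cubic s t 0 j by rewrite mxE.
  by case: Ef => ->; rewrite pull_minorE !coord ?c0 ?c1 ?c2 ?c3; ring.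
move=> vanish; have [v v0 pE] := vec_of_point p.
pose u := v *m invmx A; have vE : v = u *m A by rewrite mulmxKV.
have u0 : u != 0 by apply: contra_neq v0; rewrite vE => ->; rewrite mul0mx.
have vp : v \in point_space p by rewrite pE memv_line.
have e1 : u 0 0 * u 0 2%:R = u 0 1 * u 0 1.
  by apply/eqP; rewrite -subr_eq0 -pull_minorE -vE; apply/eqP/vanish; [constructor 1|].
have e2 : u 0 1 * u 0 3%:R = u 0 2%:R * u 0 2%:R.
  by apply/eqP; rewrite -subr_eq0 -pull_minorE -vE; apply/eqP/vanish; [constructor 2|].
have e3 : u 0 0 * u 0 3%:R = u 0 1 * u 0 2%:R.
  by apply/eqP; rewrite -subr_eq0 -pull_minorE -vE; apply/eqP/vanish; [constructor 3|].
suff [k [s [t [k0 st0 uE]]]] : exists k s t, [/\ k != 0, (s, t) != (0, 0) & cubic s t = k *: u].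
  apply/curveP; exists s, t; split=> //; rewrite pE vE uE -scalemxAl.
  by apply/eqP; rewrite eq_sym eqEdim !dim_vline -memvE memvZ ?memv_line // scaler_eq0
    (negPf k0) /= -vE leqnn.
have [u00|u00] := eqVneq (u 0 0) 0; last first.
  exists (u 0 0 ^+ 2), (u 0 0), (u 0 1).
  rewrite expf_neq0 // xpair_eqE (negPf u00); split=> //.
  have [c0 c1 c2 c3] := cubicE (u 0 0) (u 0 1).
  apply/rowP; elim/ord4_ind; rewrite [RHS]mxE ?c0 ?c1 ?c2 ?c3; first by ring.
  - by ring.
  - by apply: (eq_lincomb1 (- u 0 0) e1); ring.
  - by apply: (eq_lincomb2 (- u 0 0) (- u 0 1) e3 e1); ring.
have u01 : u 0 1 = 0.
  by apply/eqP; rewrite -(orbb (_ == 0)) -mulf_eq0 -e1 u00 mul0r.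
have u02 : u 0 2%:R = 0.
  by apply/eqP; rewrite -(orbb (_ == 0)) -mulf_eq0 -e2 u01 mul0r.
have u03 : u 0 3%:R != 0.
  by apply: contra_neq u0 => u03; apply/rowP; elim/ord4_ind; rewrite [RHS]mxE.
exists (u 0 3%:R)^-1, 0, 1; rewrite invr_neq0 // xpair_eqE oner_eq0 andbF; split=> //.
have [c0 c1 c2 c3] := cubicE (0 : K) 1.
by apply/rowP; elim/ord4_ind; rewrite [RHS]mxE ?c0 ?c1 ?c2 ?c3 ?u00 ?u01 ?u02;
  field.
Qed.

Definition pull_form (a b c : R) (i j k : 'I_4) : {mpoly R[4]} :=
  a *: pull_coord i + b *: pull_coord j + c *: pull_coord k.

Lemma eval_form (a b c : R) (p q r : {mpoly R[4]}) (v : 'I_4 -> K) :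
  (map_mpoly toC (a *: p + b *: q + c *: r)).@[v] =
  toC a * (map_mpoly toC p).@[v] + toC b * (map_mpoly toC q).@[v] +
  toC c * (map_mpoly toC r).@[v].
Proof.
have evZ x y : (map_mpoly toC (x *: y)).@[v] = toC x * (map_mpoly toC y).@[v].
  by rewrite map_mpolyZ mevalZ.
have evD x y : (map_mpoly toC (x + y)).@[v] =
    (map_mpoly toC x).@[v] + (map_mpoly toC y).@[v].
  by rewrite (raddfD (map_mpoly toC)) mevalD.
apply: etrans (evD _ _) _; congr (_ + _); last exact: evZ.
by apply: etrans (evD _ _) _; congr (_ + _); exact: evZ.
Qed.

Lemma pull_formE a b c i j k (u : 'rV[K]_4) :
  (map_mpoly toC (pull_form a b c i j k)).@[fun h => (u *m A) 0 h] =
  toC a * u 0 i + toC b * u 0 j + toC c * u 0 k.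
Proof.
apply: etrans (eval_form _ _ _ _ _ _ _) _.
by congr (_ * _ + _ * _ + _ * _); apply: pull_coordE.
Qed.

Lemma real_line_chord (a b c : R) (l : proj_line R) :
  line_space l = (act A @: chord (toC a) (toC b) (toC c))%VS -> real_line l.
Proof.
move=> lE; exists [set f | f = pull_form a b c 0 1 2%:R \/ f = pull_form a b c 1 2%:R 3%:R].
  by move=> f [] ->; exists 1; rewrite !rpredD //; apply: dhomogZ; apply: pull_coord_homog.
apply/seteqP; split=> p.
  move=> lp f Ef v vp.
  have : v \in line_space l by apply: (subvP (lp : (point_space p <= line_space l)%VS)).
  have [u ->] : exists u, v = u *m A by exists (v *m invmx A); rewrite mulmxKV.
  rewrite lE (mem_act A_unit) => /mem_chord[E1 E2].
  by case: Ef => ->; apply: etrans (pull_formE _ _ _ _ _ _ _) _.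
move=> vanish; suff : (point_space p <= line_space l)%VS by [].
apply/subvP => v; have [u ->] : exists u, v = u *m A.
  by exists (v *m invmx A); rewrite mulmxKV.
move=> up; rewrite lE (mem_act A_unit); apply/mem_chord.
by split; apply: etrans (esym (pull_formE _ _ _ _ _ _ _)) _; apply: vanish => //;
  [left|right].
Qed.

End Curve.

Lemma real_rooted_pure (a c : R) : a != 0 -> c != 0 ->
  real_rooted (toC a) 0 (toC c) <-> 0 < - (a * c).
Proof.
move=> a0 c0; have a0' : toC a != 0 by rewrite (fmorph_eq0 toC).
have c0' : toC c != 0 by rewrite (fmorph_eq0 toC).
have q0 : - a / c != 0 by rewrite mulf_neq0 ?oppr_eq0 ?invr_neq0.
have posE : (0 < - (a * c)) = (0 < - a / c).
  rewrite (_ : - (a * c) = (- a / c) * c ^+ 2); last by field.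
  by rewrite pmulr_lgt0 // exprn_even_gt0 //= c0.
have ratioE : toC (- a / c) = - toC a / toC c.
  by rewrite (rmorphM toC) (rmorphN toC) (fmorphV toC).
rewrite posE; split=> [rr|pos s t].
  have wE : sqrtC (toC (- a / c)) ^+ 2 = toC (- a / c) by rewrite sqrtCK.
  rewrite -(real_sqrt wE q0) -[sqrtC _]divr1 -real_paramE ?oner_neq0 //.
  by apply: rr; rewrite wE ratioE; field.
have [->|s0] := eqVneq s 0.
  by move=> _; rewrite /real_param conjC0 mul0r.
move=> st; rewrite real_paramE // (@real_sqrt (- a / c)) //.
rewrite ratioE; apply: (mulIf (mulf_neq0 c0' (expf_neq0 2 s0))).
by apply: (eq_lincomb1 1 st); field; rewrite c0' s0.
Qed.

Lemma chordZ (k a b c : K) : k != 0 -> chord (k * a) (k * b) (k * c) = chord a b c.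
Proof.
move=> k0; apply/vspaceP => v; apply/idP/idP => /mem_chord[E1 E2]; apply/mem_chord.
  by split; apply: (mulfI k0); [apply: (eq_lincomb1 1 E1)|apply: (eq_lincomb1 1 E2)]; ring.
by split; [apply: (eq_lincomb1 k E1)|apply: (eq_lincomb1 k E2)]; ring.
Qed.

(** Real roots have real homogeneous representatives, so the form is real up to a
   scalar. *)
Lemma real_rooted_chord (a b c : K) : b ^+ 2 != 4%:R * a * c -> real_rooted a b c ->
  exists a' b' c' : R, chord a b c = chord (toC a') (toC b') (toC c').
Proof.
move=> disc rr; have [s1 [t1 [s2 [t2 [aE bE cE]]]]] := form_factor a b c.
have st1 : real_param s1 t1 by apply: rr; rewrite aE bE cE; ring.
have st2 : real_param s2 t2 by apply: rr; rewrite aE bE cE; ring.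
have [k1 [r1 [r1' [s1E t1E]]]] := real_paramP st1.
have [k2 [r2 [r2' [s2E t2E]]]] := real_paramP st2.
exists (r1' * r2'), (- (r1 * r2' + r2 * r1')), (r1 * r2).
rewrite -[RHS](@chordZ (k1 * k2)); last first.
  apply: contra_neq disc => k0; rewrite aE bE cE s1E t1E s2E t2E.
  by apply: (eq_lincomb1 (k1 * k2 * (toC r1 * toC r2' - toC r2 * toC r1') ^+ 2) k0); ring.
have -> : k1 * k2 * toC (r1' * r2') = a by rewrite aE t1E t2E (rmorphM toC) /=; ring.
have -> : k1 * k2 * toC (r1 * r2) = c by rewrite cE s1E s2E (rmorphM toC) /=; ring.
have -> // : k1 * k2 * toC (- (r1 * r2' + r2 * r1')) = b.
by rewrite bE s1E s2E t1E t2E (rmorphN toC) (rmorphD toC) /= !(rmorphM toC) /=; ring.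
Qed.

Lemma twisted_cubic_curve (A : 'M[K]_4) : A \in unitmx -> twisted_cubic (curve A).
Proof. by move=> A_unit; exists A. Qed.

(** The line itself is then automatically real, being spanned by two real points. *)
Lemma totally_realP (A B : 'M[R]_4) (l : proj_line R) (a b c a' b' c' : K) :
  A \in unitmx -> B \in unitmx ->
  b ^+ 2 != 4%:R * a * c -> b' ^+ 2 != 4%:R * a' * c' ->
  line_space l = (act (map_mx toC A) @: chord a b c)%VS ->
  line_space l = (act (map_mx toC B) @: chord a' b' c')%VS ->
  totally_real (curve (map_mx toC A)) (curve (map_mx toC B)) l <->
  real_rooted a b c /\ real_rooted a' b' c'.
Proof.
move=> A_unit B_unit disc disc' lA lB; split=> [[_ _]|[rrA rrB]].
  by move=> /(meets_in_two_real_pointsP A_unit disc lA) ?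
            /(meets_in_two_real_pointsP B_unit disc' lB) ?.
split.
- split; apply/secantP; rewrite ?map_unitmx //; first by exists a, b, c.
  by exists a', b', c'.
- have [x [y [z E]]] := real_rooted_chord disc rrA.
  by apply: (real_line_chord A_unit (a := x) (b := y) (c := z)); rewrite -E.
- exact/(meets_in_two_real_pointsP A_unit disc lA).
- exact/(meets_in_two_real_pointsP B_unit disc' lB).
Qed.

(** The second form vanishes at the two roots of the first, since both chords contain
   the same points of the standard cubic. *)
Lemma chord_proportional (a b c a' b' c' : K) : b ^+ 2 != 4%:R * a * c ->
  chord a b c = chord a' b' c' -> [/\ a * b' = a' * b, a * c' = a' * c & b * c' = b' * c].
Proof.
move=> disc E; have [s1 [t1 [s2 [t2 [aE bE cE]]]]] := disc_factor disc.
rewrite -subr_eq0 => D.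
have root s t : a * s ^+ 2 + b * s * t + c * t ^+ 2 = 0 ->
    a' * s ^+ 2 + b' * s * t + c' * t ^+ 2 = 0.
  have one_unit : (1%:M : 'M[K]_4) \in unitmx by rewrite unitmx1.
  have [[-> ->] _|st0 st] := eqVneq (s, t) (0, 0); first by ring.
  have : (<[cubic s t *m 1%:M]> <= act (1%:M : 'M[K]_4) @: chord a b c)%VS.
    by apply/(root_on_chord one_unit); left.
  rewrite E => /(root_on_chord one_unit)[//|st00].
  by rewrite st00 eqxx in st0.
have := root s1 t1; have := root s2 t2; rewrite aE bE cE => root2 root1.
have {}root1 := root1 ltac:(ring); have {}root2 := root2 ltac:(ring).
split; apply: (mulfI D).
- by apply: (eq_lincomb2 (t2 ^+ 2) (- t1 ^+ 2) root1 root2); ring.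
- by apply: (eq_lincomb2 (- (s2 * t2)) (s1 * t1) root1 root2); ring.
- by apply: (eq_lincomb2 (s2 ^+ 2) (- s1 ^+ 2) root1 root2); ring.
Qed.

End Real.

(** * A family of pairs of cubics sharing three points *)

Lemma card_mem_seq (T : choiceType) (s : seq T) : uniq s ->
  [set x | x \in s] #= `I_(size s).
Proof.
move=> us; rewrite (_ : [set x | x \in s] = [set` [fset x in s]%fset]).
  by apply/card_eq_fsetP; rewrite card_fseq undup_id.
by apply/seteqP; split=> x /=; rewrite inE.
Qed.

Section Family.
Variable R : realType.
Local Notation K := R[i].
Local Notation act A := (linfun (mulmxr A)).
Local Notation toC := (real_complex R).
Local Notation point_space := (@point_space R).
Local Notation line_space := (@line_space R).

Variables (m n e eps : R) (h : K).
Hypotheses (eps2 : eps ^+ 2 = 1) (h2 : h ^+ 2 = toC eps).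

Let M := toC m.
Let N := toC n.
Let E := toC e.
Let S := toC eps.
Let L : K := 1 - M - E.

(** In the coordinates w it acts by w1 -> (1 - n) w1, w2 -> (1 - m - e) w2 - e w4,
   w3 -> (1 - m - e) w3 + e w4 and w4 -> w4. In the original coordinates it is real
   also when h is imaginary. *)
Definition second_mx : 'M[R]_4 := \matrix_(i, j) nth 0 (nth [::]
  [:: [:: 1 - n; 0; 0; 0];
      [:: 0; 1 - m; 0; - (eps * m)];
      [:: eps * ((1 - m - e) - (1 - n)); 0; 1 - m - e; 0];
      [:: 0; - (eps * e); 0; 1 - e]] i) j.

Lemma second_mxE (u v : 'rV[K]_4) : v = u *m map_mx toC second_mx ->
  [/\ v 0 0 = (1 - N) * u 0 0 + S * (L - (1 - N)) * u 0 2%:R,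
      v 0 1 = (1 - M) * u 0 1 - S * E * u 0 3%:R,
      v 0 2%:R = L * u 0 2%:R &
      v 0 3%:R = - (S * M) * u 0 1 + (1 - E) * u 0 3%:R].
Proof.
by move=> ->; split; rewrite mxE sum4 !mxE /= ?rmorph0 ?(rmorphN toC, rmorphM toC, rmorphB toC, rmorph1) /=;
  rewrite /N /M /E /S /L; ring.
Qed.

Hypotheses (n1 : n != 1) (l0 : 1 - m - e != 0).

Let L0 : L != 0.
Proof. by rewrite /L /M /E -(rmorph1 toC) -!(rmorphB toC) (fmorph_eq0 toC). Qed.
Let N1 : 1 - N != 0.
Proof. by rewrite /N -(rmorph1 toC) -(rmorphB toC) (fmorph_eq0 toC) subr_eq0 eq_sym. Qed.

Lemma second_mx_unit : second_mx \in unitmx.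
Proof.
rewrite -row_free_unit -kermx_eq0; apply/eqP/row_matrixP => i; rewrite row0.
set u := row i _; have : u *m second_mx = 0 by rewrite -row_mul mulmx_ker row0.
move: u => u Hu.
have coord j : (u *m second_mx) 0 j = 0 by rewrite Hu mxE.
have n1' : 1 - n != 0 by rewrite subr_eq0 eq_sym.
have := coord 0; have := coord 1; have := coord 2%:R; have := coord 3%:R.
rewrite !mxE !sum4 !mxE /= => c3 c2 c1 c0.
have u2 : u 0 2%:R = 0 by apply: (mulfI l0); apply: (eq_lincomb1 1 c2); ring.
have u0 : u 0 0 = 0.
  by apply: (mulfI n1'); apply: (eq_lincomb2 1 (- (eps * ((1 - m - e) - (1 - n)))) c0 u2); ring.
have u1 : u 0 1 = 0.
  by apply: (mulfI l0); apply: (eq_lincomb3 (1 - e) (eps * e) (m * e * u 0 1) c1 c3 eps2); ring.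
have u3 : u 0 3%:R = 0.
  by apply: (mulfI l0); apply: (eq_lincomb3 (1 - m) (eps * m) (m * e * u 0 3%:R) c3 c1 eps2); ring.
by apply/rowP; elim/ord4_ind; rewrite [RHS]mxE.
Qed.

(** The form takes the values - eps x, 2 eps y, 2 eps z at the parameters [1 : 0],
   [1 : h], [1 : - h] of the shared points. *)
Definition form_chord (p : K * K * K) : {vspace 'rV[K]_4} :=
  let: (x, y, z) := p in chord (- (S * x)) (h * (y - z)) (x + y + z).

(** In the equations of the image of a chord the coefficient of each of w1, w2, w3 is
   divided by the factor by which [second_mx] scales that coordinate; the weights undo
   this. *)
Definition weight (p : K * K * K) : K * K * K :=
  let: (x, y, z) := p in ((1 - N) * x, L * y, L * z).

Lemma h_neq0 : h != 0.
Proof.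
rewrite -sqrf_eq0 h2; apply/eqP => /(congr1 (fun z => z ^+ 2)).
by rewrite -rmorphXn /= eps2 rmorph1 expr0n; apply/eqP/oner_neq0.
Qed.

Let S2 : S ^+ 2 = 1. Proof. by rewrite -rmorphXn /= eps2 rmorph1. Qed.

Lemma mem_form_chord p (v : 'rV[K]_4) : v \in form_chord p <->
  first_chord p (v 0 2%:R - S * v 0 0) (v 0 2%:R + h * v 0 1) (v 0 2%:R - h * v 0 1)
           (h * (S * v 0 3%:R - v 0 1)).
Proof.
case: p => [[x y] z]; rewrite /form_chord mem_chord /first_chord; split=> -[E1 E2]; split.
- by apply: (eq_lincomb1 1 E1); ring.
- by apply: (eq_lincomb3 (h * S) (- (S * (y - z) * v 0 2%:R))
    (h * x * v 0 1 - (y - z) * v 0 2%:R) E2 h2 S2); rewrite -/S; ring.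
- by apply: (eq_lincomb1 1 E1); ring.
- by apply: (eq_lincomb3 h (x * v 0 1 - (x + y + z) * v 0 3%:R * S)
    (- ((x + y + z) * v 0 3%:R)) E2 h2 S2); rewrite -/S; ring.
Qed.

Lemma mem_form_second_chord p (v : 'rV[K]_4) :
  (v \in act (map_mx toC second_mx) @: form_chord (weight p))%VS <->
  second_chord M N E p (v 0 2%:R - S * v 0 0) (v 0 2%:R + h * v 0 1) (v 0 2%:R - h * v 0 1)
           (h * (S * v 0 3%:R - v 0 1)).
Proof.
have B_unit : map_mx toC second_mx \in unitmx by rewrite map_unitmx second_mx_unit.
have [u vE] : exists u, v = u *m map_mx toC second_mx.
  by exists (v *m invmx (map_mx toC second_mx)); rewrite mulmxKV.
rewrite [v in v \in _]vE (mem_act B_unit) mem_form_chord.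
have [v0 v1 v2 v3] := second_mxE vE.
set w1 := u 0 2%:R - S * u 0 0; set w2 := u 0 2%:R + h * u 0 1.
set w3 := u 0 2%:R - h * u 0 1; set w4 := h * (S * u 0 3%:R - u 0 1).
have -> : v 0 2%:R - S * v 0 0 = (1 - N) * w1.
  by rewrite v0 v2; apply: (eq_lincomb1 (- ((L - (1 - N)) * u 0 2%:R)) S2); rewrite /w1; ring.
have -> : v 0 2%:R + h * v 0 1 = L * w2 - E * w4.
  by rewrite v1 v2 /w2 /w4 /L; ring.
have -> : v 0 2%:R - h * v 0 1 = L * w3 + E * w4.
  by rewrite v1 v2 /w3 /w4 /L; ring.
have -> : h * (S * v 0 3%:R - v 0 1) = w4.
  by rewrite v1 v3; apply: (eq_lincomb1 (- (h * M * u 0 1)) S2); rewrite /w4; ring.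
case: p => [[x y] z]; rewrite /weight /first_chord /second_chord /L; split=> -[E1 E2]; split.
- by apply: (eq_lincomb1 1 E1); ring.
- by apply: (eq_lincomb1 1 E2); ring.
- by apply: (eq_lincomb1 1 E1); ring.
- by apply: (eq_lincomb1 1 E2); ring.
Qed.

Lemma S_neq0 : S != 0.
Proof. by rewrite /S -h2 expf_neq0 // h_neq0. Qed.

Lemma chord_coords_surj (w1 w2 w3 w4 : K) : exists v : 'rV[K]_4,
  [/\ v 0 2%:R - S * v 0 0 = w1, v 0 2%:R + h * v 0 1 = w2,
      v 0 2%:R - h * v 0 1 = w3 & h * (S * v 0 3%:R - v 0 1) = w4].
Proof.
have h0 := h_neq0; have S0 := S_neq0.
pose v1 := (w2 - w3) / (2%:R * h); pose v2 := (w2 + w3) / 2%:R.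
exists (\row_j [:: (v2 - w1) / S; v1; v2; (w4 / h + v1) / S]`_j).
by rewrite !mxE /= /v1 /v2; split; field; rewrite ?h0 ?S0.
Qed.

Definition nondegenerate (p : K * K * K) : bool :=
  let: (x, y, z) := p in
  (h * (y - z)) ^+ 2 != 4%:R * (- (S * x)) * (x + y + z).

Definition real_form (p : K * K * K) : Prop :=
  let: (x, y, z) := p in real_rooted (- (S * x)) (h * (y - z)) (x + y + z).

Lemma form_surj (a b c : K) : exists x y z,
  [/\ a = - (S * x), b = h * (y - z) & c = x + y + z].
Proof.
have h0 := h_neq0; have S0 := S_neq0.
exists (- a / S), ((c + a / S + b / h) / 2%:R), ((c + a / S - b / h) / 2%:R).
by split; field; rewrite ?h0 ?S0.
Qed.

Lemma nondegenerate_neq0 p : nondegenerate p -> p != (0, 0, 0).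
Proof. by apply: contraTneq => ->; rewrite /nondegenerate negbK; apply/eqP; ring. Qed.

Lemma dim_form_chord p : nondegenerate p -> \dim (form_chord p) = 2%N.
Proof. by case: p => [[x y] z] /= nd; apply/dim_chord/disc_neq0. Qed.

Let C1 := curve (map_mx toC (1%:M : 'M[R]_4)).
Let C2 := curve (map_mx toC second_mx).
Let A1 : (1%:M : 'M[R]_4) \in unitmx := unitmx1 _ _.
Let A2 := second_mx_unit.
Let B1 : map_mx toC (1%:M : 'M[R]_4) \in unitmx.
Proof. by rewrite map_unitmx unitmx1. Qed.
Let B2 : map_mx toC second_mx \in unitmx.
Proof. by rewrite map_unitmx second_mx_unit. Qed.

Lemma act_id (U : {vspace 'rV[K]_4}) : (act (map_mx toC (1%:M : 'M[R]_4)) @: U)%VS = U.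
Proof. by apply/vspaceP => v; have := mem_act B1 U v; rewrite map_mx1 mulmx1. Qed.

Lemma same_chordP p q : same_chord M N E p q <->
  form_chord p = (act (map_mx toC second_mx) @: form_chord (weight q))%VS.
Proof.
split=> [pq|pq w1 w2 w3 w4].
  apply/vspaceP => v; apply/idP/idP.
    by move=> /mem_form_chord/pq/mem_form_second_chord.
  by move=> /mem_form_second_chord/pq/mem_form_chord.
have [v [<- <- <- <-]] := chord_coords_surj w1 w2 w3 w4.
split=> [/mem_form_chord|/mem_form_second_chord].
  by rewrite pq => /mem_form_second_chord.
by rewrite -pq => /mem_form_chord.
Qed.

Lemma common_secantP (l : proj_line R) : common_secant C1 C2 l <-> exists p q,
  [/\ nondegenerate p, nondegenerate (weight q), same_chord M N E p q & line_space l = form_chord p].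
Proof.
split.
  move=> [/(secantP B1)[a [b [c [disc lE]]]] /(secantP B2)[a' [b' [c' [disc' lE']]]]].
  have [x [y [z [aE bE cE]]]] := form_surj a b c.
  have [x' [y' [z' [aE' bE' cE']]]] := form_surj a' b' c'.
  have wE : weight (x' / (1 - N), y' / L, z' / L) = (x', y', z').
    by rewrite /weight; congr (_, _, _); rewrite mulrC divfK.
  exists (x, y, z), (x' / (1 - N), y' / L, z' / L).
  have {}lE : line_space l = chord a b c := etrans lE (act_id _).
  split; first by rewrite /nondegenerate -aE -bE -cE.
  - by rewrite wE /nondegenerate -aE' -bE' -cE'.
  - by apply/same_chordP; rewrite wE /form_chord -aE -bE -cE -aE' -bE' -cE' -lE.
  - by rewrite lE /form_chord -aE -bE -cE.
move=> [[[x y] z] [q [nd nd' /same_chordP pq lE]]].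
split; [apply/(secantP B1)|apply/(secantP B2)].
  by exists (- (S * x)), (h * (y - z)), (x + y + z); rewrite act_id.
move: nd' pq; rewrite -lE; case: (weight q) => [[x' y'] z'] nd' ->.
by exists (- (S * x')), (h * (y' - z')), (x' + y' + z').
Qed.

(** The data needed to count the line of a triple: it is a common secant, and the boolean
   tells whether it is totally real. One inclusion between the two chords is enough
   because both have dimension 2. *)
Definition certified (pb : (K * K * K) * bool) : Prop := exists q,
  [/\ forall w1 w2 w3 w4, first_chord pb.1 w1 w2 w3 w4 -> second_chord M N E q w1 w2 w3 w4,
      nondegenerate pb.1, nondegenerate (weight q) &
      real_form pb.1 /\ real_form (weight q) <-> pb.2].

Lemma certifiedP p b (l : proj_line R) : certified (p, b) -> line_space l = form_chord p ->
  common_secant C1 C2 l /\ (totally_real C1 C2 l <-> b).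
Proof.
move=> [q [/= sub nd nd' rr]] lE.
have pq : form_chord p = (act (map_mx toC second_mx) @: form_chord (weight q))%VS.
  apply/eqP; rewrite eqEdim (dim_act B2) !dim_form_chord // leqnn andbT.
  by apply/subvP => v /mem_form_chord/sub/mem_form_second_chord.
split; first by apply/common_secantP; exists p, q; split=> //; apply/same_chordP.
apply: iff_trans rr.
have lE1 : line_space l = (act (map_mx toC (1%:M : 'M[R]_4)) @: form_chord p)%VS by rewrite act_id.
rewrite pq in lE; move: nd lE1 lE nd'.
case: p {sub pq} => [[x y] z]; case: (weight q) => [[x' y'] z'] nd lE1 lE2 nd'.
exact: (totally_realP A1 A2 nd nd' lE1 lE2).
Qed.

Definition proportional (p q : K * K * K) : bool :=
  [&& p.1.1 * q.1.2 == q.1.1 * p.1.2, p.1.1 * q.2 == q.1.1 * p.2 & p.1.2 * q.2 == q.1.2 * p.2].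

Lemma form_chord_proportional p q : nondegenerate p -> form_chord p = form_chord q ->
  proportional p q.
Proof.
have h0 := h_neq0; have S0 := S_neq0.
have two0 : 2%:R != 0 :> K by rewrite pnatr_eq0.
case: p q => [[x y] z] [[x' y'] z'] nd /(chord_proportional nd)[ab ac bc].
have nz : 2%:R * S * h != 0 by rewrite !mulf_neq0.
apply/and3P; split; apply/eqP; apply: (mulfI nz) => /=.
- by apply: (eq_lincomb2 (- 1) (- h) ab ac); ring.
- by apply: (eq_lincomb2 1 (- h) ab ac); ring.
- by apply: (eq_lincomb2 (-1) S ab bc); ring.
Qed.

Lemma default_line_dim : \dim (chord (1 : K) 0 0) == 2%N.
Proof. by rewrite dim_chord // !xpair_eqE oner_eq0. Qed.

Definition line_of (p : K * K * K) : proj_line R :=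
  insubd (exist (fun l : {vspace 'rV[K]_4} => \dim l == 2%N) _ default_line_dim)
    (form_chord p).

Lemma line_space_line_of p : nondegenerate p -> line_space (line_of p) = form_chord p.
Proof. by move=> nd; apply: insubdK; rewrite unfold_in dim_form_chord. Qed.

Lemma form_chord_scale k p : k != 0 -> form_chord (scale k p) = form_chord p.
Proof.
case: p => [[x y] z] k0; rewrite /form_chord /scale -[RHS](chordZ _ _ _ k0).
have -> : k * - (S * x) = - (S * (k * x)) by ring.
have -> : k * (h * (y - z)) = h * (k * y - k * z) by ring.
by have -> : k * (x + y + z) = k * x + k * y + k * z by ring.
Qed.

(** Lines correspond to triples up to scale, so a complete list of pairwise
   non-proportional triples counts the common secants. *)
Lemma count_secants (qs : seq ((K * K * K) * bool)) :
  (forall x, x \in qs -> certified x) ->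
  pairwise (fun x y => ~~ proportional x.1 y.1) qs ->
  (forall p q, p != (0, 0, 0) -> same_chord M N E p q ->
     exists k x, [/\ k != 0, x \in qs & p = scale k x.1]) ->
  [set l | common_secant C1 C2 l] #= `I_(size qs) /\
  [set l | totally_real C1 C2 l] #= `I_(count snd qs).
Proof.
move=> entries pw complete.
pose f (x : (K * K * K) * bool) := line_of x.1.
have nd x : x \in qs -> nondegenerate x.1 by move/entries => [q [_ ? _ _]].
have commonE l : common_secant C1 C2 l -> exists2 x, x \in qs & l = f x.
  move=> /common_secantP[p [q [ndp _ pq lE]]].
  have [k [x [k0 xqs pE]]] := complete _ _ (nondegenerate_neq0 ndp) pq.
  exists x => //; apply: line_space_inj; rewrite lE /f line_space_line_of ?nd //.
  by rewrite pE form_chord_scale.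
have uf : uniq (map f qs).
  rewrite uniq_pairwise pairwise_map.
  apply: (@sub_in_pairwise _ (mem qs) _ _ _ _ _ pw); last by apply/allP.
  move=> x y /nd ndx /nd ndy; apply: contra => /eqP fxy.
  by apply: form_chord_proportional => //; rewrite -!line_space_line_of // -/(f x) fxy.
split.
  rewrite -(size_map f) (_ : [set l | _] = [set l | l \in map f qs]).
    exact: card_mem_seq.
  apply/seteqP; split=> l /=; first by move=> /commonE[x xqs ->]; apply: map_f.
  move=> /mapP[[p b] xqs ->].
  by have [] := certifiedP (entries _ xqs) (line_space_line_of (nd _ xqs)).
rewrite -size_filter -(size_map f) (_ : [set l | _] = [set l | l \in map f (filter snd qs)]).
  apply: card_mem_seq; apply: subseq_uniq uf; apply: map_subseq; exact: filter_subseq.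
apply/seteqP; split=> l /=.
  move=> tr; have [cs _ _ _] := tr; have [[p b] xqs lE] := commonE _ cs.
  rewrite lE; apply: map_f; rewrite mem_filter xqs andbT /=.
  have [_ <-] := certifiedP (entries _ xqs) (line_space_line_of (nd _ xqs)).
  by rewrite -/(f (p, b)) -lE.
move=> /mapP[[p b]]; rewrite mem_filter => /andP[/= bT xqs] ->.
by have [_ ->] := certifiedP (entries _ xqs) (line_space_line_of (nd _ xqs)).
Qed.

Definition has_roots (p : K * K * K) (s1 t1 s2 t2 : K) : Prop :=
  let: (x, y, z) := p in
  [/\ - (S * x) = t1 * t2, h * (y - z) = - (s1 * t2 + s2 * t1),
      x + y + z = s1 * s2 & s1 * t2 != s2 * t1].

Lemma has_roots_nondegenerate p s1 t1 s2 t2 : has_roots p s1 t1 s2 t2 -> nondegenerate p.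
Proof.
case: p => [[x y] z] [/= aE bE cE D].
rewrite /nondegenerate aE bE cE -subr_eq0.
rewrite (_ : _ - _ = (s1 * t2 - s2 * t1) ^+ 2); last by ring.
by rewrite expf_neq0 // subr_eq0.
Qed.

Lemma has_roots_real p s1 t1 s2 t2 : has_roots p s1 t1 s2 t2 ->
  real_form p <-> real_param s1 t1 /\ real_param s2 t2.
Proof.
case: p => [[x y] z] [/= -> -> -> /params_neq0[st1 st2]].
exact: real_rooted_factor.
Qed.

Lemma certified_roots p q s1 t1 s2 t2 s1' t1' s2' t2' (b : bool) :
  (forall w1 w2 w3 w4, first_chord p w1 w2 w3 w4 -> second_chord M N E q w1 w2 w3 w4) ->
  has_roots p s1 t1 s2 t2 -> has_roots (weight q) s1' t1' s2' t2' ->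
  (b -> [/\ real_param s1 t1, real_param s2 t2, real_param s1' t1' & real_param s2' t2']) ->
  (real_param s1 t1 /\ real_param s2 t2 -> b) ->
  certified (p, b).
Proof.
move=> sub r1 r2 br rb; exists q; split=> //.
- exact: has_roots_nondegenerate r1.
- exact: has_roots_nondegenerate r2.
split; first by move=> [/(has_roots_real r1) + _].
move=> /br[? ? ? ?]; split; first by apply/(has_roots_real r1).
by apply/(has_roots_real r2).
Qed.

Let h_real : (h \is Num.real) = (0 < eps).
Proof.
apply: (real_sqrt h2); apply/eqP => eps0; move: eps2.
by rewrite eps0 expr0n => /eqP; rewrite eq_sym oner_eq0.
Qed.

Let two0 : 2%:R != 0 :> K. Proof. by rewrite pnatr_eq0. Qed.
Let h0 := h_neq0.
Let S0 := S_neq0.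

Lemma neq_sub (a b : K) : a - b != 0 -> a != b.
Proof. by rewrite subr_eq0. Qed.

(* D is the determinant s1 t2 - s2 t1 that separates the two roots. *)
Ltac roots D := split; [by rewrite /S -?h2; ring | by ring | by ring |
  apply: neq_sub; rewrite (_ : _ - _ = D); [rewrite ?oppr_eq0 ?mulf_neq0 // |
    by rewrite /S -?h2; ring]].

Lemma certified_join1 : certified ((1, 0, 0), 0 < eps).
Proof.
apply: (@certified_roots _ (1, 0, 0) 1 h 1 (- h) (1 - N) ((1 - N) * h) 1 (- h)).
- by move=> *; apply: chord_join1.
- by roots (- (2%:R * h)).
- by roots (- (2%:R * h * (1 - N))).
- by move=> b; rewrite !real_paramE ?oner_neq0 // !divr1 mulrAC divff // mul1r rpredN h_real.
- by rewrite real_paramE ?oner_neq0 // divr1 h_real => -[].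
Qed.

Lemma certified_join2 : certified ((0, 1, 0), 0 < eps).
Proof.
apply: (@certified_roots _ (0, 1, 0) 1 0 1 (- h) L 0 1 (- h)).
- by move=> *; apply: chord_join2.
- by roots (- h).
- by roots (- (L * h)).
- by move=> b; rewrite !real_paramE ?oner_neq0 // !mul0r rpred0 divr1 rpredN h_real.
- by rewrite !real_paramE ?oner_neq0 // !divr1 rpredN h_real => -[].
Qed.

Lemma certified_join3 : certified ((0, 0, 1), 0 < eps).
Proof.
apply: (@certified_roots _ (0, 0, 1) 1 0 1 h L 0 1 h).
- by move=> *; apply: chord_join3.
- by roots h.
- by roots (L * h).
- by move=> b; rewrite !real_paramE ?oner_neq0 // !mul0r rpred0 divr1 h_real.
- by rewrite !real_paramE ?oner_neq0 // !divr1 h_real => -[].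
Qed.

Hypotheses (m0 : m != 0) (e0 : e != 0) (n0 : n != 0).
Let M0 : M != 0. Proof. by rewrite /M (fmorph_eq0 toC). Qed.
Let E0 : E != 0. Proof. by rewrite /E (fmorph_eq0 toC). Qed.
Let N0 : N != 0. Proof. by rewrite /N (fmorph_eq0 toC). Qed.

(** Besides the shared point the line meets the cubics at the parameters - h om and
   - eps m / (e h om), which are real together. *)
Lemma certified_through1 (om : K) : om != 0 -> E * (1 - M) * om ^+ 2 = M * (1 - E) ->
  certified ((0, 1 + om, 1 - om), h * om \is Num.real).
Proof.
move=> om0 om2.
apply: (@certified_roots _ (0, E * om + M, E * om - M) 1 0 2%:R (- (2%:R * h * om))
   L 0 (2%:R * E * om) (- (2%:R * h * M))).
- by move=> *; apply: chord_through1.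
- by roots (- (2%:R * h * om)); rewrite ?mulf_neq0.
- by roots (- (2%:R * h * M * L)); rewrite ?mulf_neq0.
- move=> b; rewrite !real_paramE ?oner_neq0 ?mulf_neq0 // !mul0r rpred0; split=> //.
    rewrite (_ : _ / _ = - (h * om)) ?rpredN //; by field.
  rewrite (_ : _ / _ = - (h ^+ 2 * M / E) / (h * om)); last by field; rewrite h0 om0 E0.
  rewrite h2 rpred_div // rpredN rpred_div ?toC_real // rpredM ?toC_real //.
- rewrite !real_paramE ?oner_neq0 // => -[_].
  by rewrite (_ : _ / _ = - (h * om)) ?rpredN //; field.
Qed.

Lemma real_of_shifted_param (g r : K) : g != 0 -> g \is Num.real -> real_param (1 + r) g ->
  r \is Num.real.
Proof.
move=> g0 gR; have [r1 _|r1] := eqVneq (1 + r) 0.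
  by rewrite -[r](addKr 1) r1 addr0 rpredN rpred1.
rewrite real_paramE // => qR.
have -> : r = g / (g / (1 + r)) - 1 by field; rewrite g0 r1.
by rewrite rpredB ?rpred1 // rpred_div.
Qed.

(** The shared point itself has parameter h, so reality needs h real; then the other
   parameters are real exactly when r is. *)
Lemma certified_through2 (r : K) : 2%:R + r != 0 -> 2%:R * (1 + M * r) + L * r != 0 ->
  M * r ^+ 2 + (N + M + E - N * E) * r + N = 0 ->
  certified ((1, 0, r), (0 < eps) && (r \is Num.real)).
Proof.
move=> nd nd' rE.
apply: (@certified_roots _ (1 + M * r, 0, (1 - N) * r) 1 h (1 + r) (- h)
   (1 - N) ((1 - N) * h) (1 + M * r + L * r) (- ((1 + M * r) * h))).
- by move=> *; apply: chord_through2.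
- by roots (- (h * (2%:R + r))); rewrite mulf_neq0.
- by roots (- ((1 - N) * h * (2%:R * (1 + M * r) + L * r))); rewrite !mulf_neq0.
- move=> /andP[]; rewrite -h_real => hR rR.
  have MR := toC_real m; have ER := toC_real e; have NR := toC_real n.
  by split; apply: real_param_reals; rewrite ?(rpredN, rpredM, rpredD, rpred1, rpredB).
- rewrite real_paramE ?oner_neq0 // divr1 -h_real => -[hR].
  by rewrite hR /=; apply: real_of_shifted_param; rewrite ?oppr_eq0 ?rpredN.
Qed.

Lemma certified_through3 (r : K) : 2%:R + r != 0 -> 2%:R * (1 + M * r) + L * r != 0 ->
  M * r ^+ 2 + (N + M + E - N * E) * r + N = 0 ->
  certified ((1, r, 0), (0 < eps) && (r \is Num.real)).
Proof.
move=> nd nd' rE.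
apply: (@certified_roots _ (1 + M * r, (1 - N) * r, 0) 1 (- h) (1 + r) h
   (1 - N) (- ((1 - N) * h)) (1 + M * r + L * r) ((1 + M * r) * h)).
- by move=> *; apply: chord_through3.
- by roots (h * (2%:R + r)); rewrite mulf_neq0.
- by roots ((1 - N) * h * (2%:R * (1 + M * r) + L * r)); rewrite !mulf_neq0.
- move=> /andP[]; rewrite -h_real => hR rR.
  have MR := toC_real m; have ER := toC_real e; have NR := toC_real n.
  by split; apply: real_param_reals; rewrite ?(rpredN, rpredM, rpredD, rpred1, rpredB).
- rewrite real_paramE ?oner_neq0 // divr1 rpredN -h_real => -[hR].
  by rewrite hR /=; apply: (real_of_shifted_param h0).
Qed.

(** Both forms lack the middle term, so their roots are real exactly when the outer
   coefficients have opposite signs. *)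
Lemma certified_lonely : m != n -> m - n + n * e != 0 ->
  certified ((2%:R * M, - N, - N),
    (0 < eps * m * (m - n)) && (0 < eps * (1 - n) * m * (m - n + n * e))).
Proof.
move=> mn mne.
have eps0 : eps != 0.
  by apply/eqP => eps0; move: eps2; rewrite eps0 expr0n => /eqP; rewrite eq_sym oner_eq0.
have d0 : m - n != 0 by rewrite subr_eq0.
have n1' : 1 - n != 0 by rewrite subr_eq0 eq_sym.
have two0' : 2%:R != 0 :> R by rewrite pnatr_eq0.
pose a := - (eps * (2%:R * m)); pose c := 2%:R * (m - n).
pose a' := - (eps * ((1 - n) * (2%:R * m))); pose c' := 2%:R * (m - n + n * e).
have a0 : a != 0 by rewrite oppr_eq0 !mulf_neq0.
have c0 : c != 0 by rewrite mulf_neq0.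
have a0' : a' != 0 by rewrite oppr_eq0 !mulf_neq0.
have c0' : c' != 0 by rewrite mulf_neq0.
have aE : - (S * (2%:R * M)) = toC a.
  by rewrite /a /S /M; ring.
have cE : 2%:R * M + - N + - N = toC c.
  by rewrite /c /M /N; ring.
have aE' : - (S * ((1 - N) * (2%:R * M))) = toC a'.
  by rewrite /a' /S /M /N; ring.
have cE' : (1 - N) * (2%:R * M) + L * - N + L * - N = toC c'.
  by rewrite /c' /L /M /N /E; ring.
have bE : h * (- N - - N) = 0 by ring.
have bE' : h * (L * - N - L * - N) = 0 by ring.
have nz x y : x != 0 -> y != 0 -> 0 ^+ 2 != 4%:R * toC x * toC y :> K.
  move=> x0 y0; rewrite expr0n eq_sym !mulf_neq0 ?(fmorph_eq0 toC) //.
  by rewrite pnatr_eq0.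
exists (2%:R * M, - N, - N); split.
- by move=> *; apply: chord_lonely.
- by rewrite /nondegenerate /= aE cE bE nz.
- by rewrite /nondegenerate /weight /= aE' cE' bE' nz.
rewrite /real_form /weight /= aE cE bE aE' cE' bE'.
have -> : (0 < eps * m * (m - n)) = (0 < - (a * c)).
  rewrite (_ : - (a * c) = 4%:R * (eps * m * (m - n))); last by rewrite /a /c; ring.
  by rewrite [RHS]pmulr_rgt0 ?ltr0n.
have -> : (0 < eps * (1 - n) * m * (m - n + n * e)) = (0 < - (a' * c')).
  rewrite (_ : - (a' * c') = 4%:R * (eps * (1 - n) * m * (m - n + n * e))); last first.
    by rewrite /a' /c'; ring.
  by rewrite [RHS]pmulr_rgt0 ?ltr0n.
split=> [[/(real_rooted_pure a0 c0)-> /(real_rooted_pure a0' c0')-> //]|/andP[p1 p2]].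
by split; [apply/(real_rooted_pure a0 c0)|apply/(real_rooted_pure a0' c0')].
Qed.

Let g := n + m + e - n * e.
Hypotheses (m1 : m != 1) (e1 : e != 1) (me : m != e) (mn : m != n).
Hypothesis (mne : m - n + n * e != 0).
Hypothesis (disc0 : g ^+ 2 - 4%:R * m * n != 0).
(** The next two conditions keep the secants through the second and third shared points
   from being tangent there to the first, respectively to the second cubic. *)
Hypothesis (tangent1 : 4%:R * m - 2%:R * g + n != 0).
Hypothesis (tangent2 : 4%:R * m - 2%:R * g * (1 + m - e) + n * (1 + m - e) ^+ 2 != 0).

Lemma family_counts :
  [set l | common_secant C1 C2 l] #= `I_10 /\
  [set l | totally_real C1 C2 l] #=
    `I_(3 * (0 < eps)%R + 2 * (0 < eps * (m * (1 - e)) * (e * (1 - m)))%R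
        + 4 * ((0 < eps) && (0 < g ^+ 2 - 4%:R * m * n))%R
        + ((0 < eps * m * (m - n)) && (0 < eps * (1 - n) * m * (m - n + n * e)))%R).
Proof.
have toC_neq0 x : x != 0 -> toC x != 0 by rewrite (fmorph_eq0 toC).
have em1 : e * (1 - m) != 0 by rewrite mulf_neq0 // subr_eq0 eq_sym.
have me1 : m * (1 - e) != 0 by rewrite mulf_neq0 // subr_eq0 eq_sym.
have eps0 : eps != 0.
  by apply/eqP => eps0; move: eps2; rewrite eps0 expr0n => /eqP; rewrite eq_sym oner_eq0.
have EM1 : E * (1 - M) != 0.
  by rewrite (_ : E * (1 - M) = toC (e * (1 - m))) ?toC_neq0 // /E /M; ring.
have ME1 : M * (1 - E) != 0.
  by rewrite (_ : M * (1 - E) = toC (m * (1 - e))) ?toC_neq0 // /E /M; ring.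
have ME : M - E != 0.
  by rewrite (_ : M - E = toC (m - e)) ?toC_neq0 ?subr_eq0 // /E /M; ring.
pose om := sqrtC (M * (1 - E) / (E * (1 - M))).
have om2 : E * (1 - M) * om ^+ 2 = M * (1 - E).
  by rewrite sqrtCK mulrC divfK.
have om0 : om != 0 by rewrite sqrtC_eq0 mulf_neq0 // invr_neq0.
have om_neq1 : (1 + om) * (1 - om) != 0.
  apply: contra_neq ME => H.
  by apply: (eq_lincomb2 (- (E * (1 - M))) (- 1) H om2); ring.
move: (om_neq1); rewrite mulf_eq0 negb_or => /andP[om_p om_m].
have homE : (h * om \is Num.real) = (0 < eps * (m * (1 - e)) * (e * (1 - m))).
  rewrite (@real_sqrt _ (eps * (m * (1 - e)) / (e * (1 - m)))).
  - rewrite (_ : eps * (m * (1 - e)) * (e * (1 - m)) =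
      (eps * (m * (1 - e)) / (e * (1 - m))) * (e * (1 - m)) ^+ 2); last first.
      by field; rewrite e0 subr_eq0 eq_sym m1.
    by rewrite [RHS]pmulr_lgt0 // exprn_even_gt0 //= em1.
  - set x := _ / _; have xE : toC (e * (1 - m)) * toC x = toC (eps * (m * (1 - e))).
      by rewrite -(rmorphM toC) /x mulrC divfK.
    apply: (mulfI EM1); rewrite exprMn h2 mulrCA om2.
    apply: etrans (etrans _ (esym xE)) _; last by rewrite /E /M; ring.
    by rewrite /E /M; ring.
  - by rewrite mulf_neq0 ?invr_neq0 // mulf_neq0.
have hom'E : (h * - om \is Num.real) = (0 < eps * (m * (1 - e)) * (e * (1 - m))).
  by rewrite mulrN rpredN homE.
pose G := N + M + E - N * E; pose D := g ^+ 2 - 4%:R * m * n.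
pose d := sqrtC (toC D).
have d2 : d ^+ 2 = toC D by rewrite sqrtCK.
have DE : toC D = G ^+ 2 - 4%:R * M * N by rewrite /D /g /G /M /N /E; ring.
have d0 : d != 0 by rewrite sqrtC_eq0 toC_neq0.
have dR : (d \is Num.real) = (0 < D) by apply: real_sqrt.
pose r1 := (- G + d) / (2%:R * M); pose r2 := (- G - d) / (2%:R * M).
have r_sum : M * (r1 + r2) = - G by rewrite /r1 /r2; field; rewrite M0.
have r_prod : M * (r1 * r2) = N.
  rewrite (_ : M * (r1 * r2) = (G ^+ 2 - d ^+ 2) / (4%:R * M)); last first.
    by rewrite /r1 /r2; field; rewrite M0.
  by rewrite d2 DE; field; rewrite M0.
have r1E : M * r1 ^+ 2 + G * r1 + N = 0.
  by apply: (eq_lincomb2 r1 (- 1) r_sum r_prod); ring.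
have r2E : M * r2 ^+ 2 + G * r2 + N = 0.
  by apply: (eq_lincomb2 r2 (- 1) r_sum r_prod); ring.
have r12 : r1 - r2 != 0.
  by rewrite (_ : r1 - r2 = d / M) ?mulf_neq0 ?invr_neq0 // /r1 /r2; field; rewrite M0.
have r_neq0 r : M * r ^+ 2 + G * r + N = 0 -> r != 0.
  by move=> H; apply: contra_neq N0 => r0; apply: (eq_lincomb2 1 (- (M * r + G)) H r0); ring.
have tan1 r : M * r ^+ 2 + G * r + N = 0 -> 2%:R + r != 0.
  move=> H; have : toC (4%:R * m - 2%:R * g + n) != 0 by rewrite toC_neq0.
  apply: contra_neq => H2.
  apply: (eq_lincomb2 1 (- (M * (r - 2%:R) + G)) H H2); rewrite /g /G /M /N /E; ring.
have tan2 r : M * r ^+ 2 + G * r + N = 0 -> 2%:R * (1 + M * r) + L * r != 0.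
  move=> H.
  have : toC (4%:R * m - 2%:R * g * (1 + m - e) + n * (1 + m - e) ^+ 2) != 0.
    by rewrite toC_neq0.
  apply: contra_neq => H2; pose k := 1 + M - E.
  apply: (eq_lincomb2 (k ^+ 2) (- (M * (k * r - 2%:R) + G * k)) H H2).
  by rewrite /k /g /G /L /M /N /E; ring.
have MR : M \is Num.real := toC_real m.
have GR : G \is Num.real.
  by rewrite /G; have := (toC_real n, toC_real m, toC_real e) => -[[? ?] ?];
    rewrite ?(rpredB, rpredD, rpredM).
have twoR : 2%:R \is @Num.real K by rewrite realn.
have twoM : 2%:R * M \is Num.real by exact: rpredM.
have r1R : (r1 \is Num.real) = (0 < D).
  rewrite -dR; apply/idP/idP => H.
    rewrite (_ : d = 2%:R * M * r1 + G); first by exact: rpredD (rpredM twoM H) GR.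
    by rewrite /r1; field; rewrite M0.
  by apply: rpred_div => //; apply: rpredD => //; rewrite rpredN.
have r2R : (r2 \is Num.real) = (0 < D).
  rewrite -dR; apply/idP/idP => H.
    rewrite (_ : d = - (2%:R * M * r2 + G)).
      by rewrite rpredN; exact: rpredD (rpredM twoM H) GR.
    by rewrite /r2; field; rewrite M0.
  by apply: rpred_div => //; apply: rpredB => //; rewrite rpredN.
pose bj := 0 < eps; pose bc := 0 < eps * (m * (1 - e)) * (e * (1 - m)).
pose br := (0 < eps) && (0 < D).
pose bl := (0 < eps * m * (m - n)) && (0 < eps * (1 - n) * m * (m - n + n * e)).
pose qs : seq ((K * K * K) * bool) :=
  zip (common_chords M N om r1 r2) [:: bj; bj; bj; bc; bc; br; br; br; br; bl].
have [||| cc tr] := @count_secants qs.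
- move=> x; rewrite /qs /= !inE => xqs.
  have certified_r r : M * r ^+ 2 + G * r + N = 0 -> (r \is Num.real) = (0 < D) ->
      certified ((1, 0, r), br) /\ certified ((1, r, 0), br).
    move=> rE rR; rewrite /br -rR.
    by split; [apply: certified_through2|apply: certified_through3]; rewrite ?tan1 ?tan2.
  have [er1 er1'] := certified_r _ r1E r1R; have [er2 er2'] := certified_r _ r2E r2R.
  have ec : certified ((0, 1 + om, 1 - om), bc) by rewrite /bc -homE; apply: certified_through1.
  have ec' : certified ((0, 1 - om, 1 + om), bc).
    rewrite /bc -hom'E -[in 1 + om](opprK om); apply: certified_through1; rewrite ?oppr_eq0 //.
    by rewrite sqrrN.
  move: xqs; do ![case/orP]; move/eqP => -> //.
  + exact: certified_join1.
  + exact: certified_join2.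
  + exact: certified_join3.
  + exact: certified_lonely.
- have om_pm : (1 + om) * (1 + om) != (1 - om) * (1 - om).
    rewrite -subr_eq0 (_ : _ - _ = 2%:R * 2%:R * om); last by ring.
    by rewrite !mulf_neq0.
  have r10 := r_neq0 _ r1E; have r20 := r_neq0 _ r2E.
  have r21 : (r2 == r1) = false by rewrite eq_sym -subr_eq0 (negPf r12).
  rewrite /qs /= /proportional /= !(mul0r, mulr0, mul1r, mulr1) !eqxx.
  have zero_eq (x : K) : (0 == x) = (x == 0) by rewrite eq_sym.
  (* Only the non-vanishing facts collected above matter from here on. *)
  clearbody r1 r2 om.
  rewrite !zero_eq ?(mulf_eq0, oppr_eq0, oner_eq0) (negPf om_p) (negPf om_m) (negPf r10).
  rewrite (negPf r20) (negPf om_pm) r21 (negPf M0) (negPf N0) (negPf two0) /= ?andbF.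
  by [].
- move=> p q p0 pq.
  have M1' : M != 1.
    by apply: contra_neq EM1 => ->; rewrite subrr mulr0.
  have [k [p1 [k0 p1in pE]]] := same_chord_common two0 M0 N0 E0 M1' om2 r_sum r_prod p0 pq.
  have /mapP[x xqs xE] : p1 \in map fst qs by rewrite -/(unzip1 qs) unzip1_zip.
  by exists k, x; rewrite -xE.
split=> //; move: tr; rewrite /qs /= -/(g ^+ 2) -/D -/br -/bl -/bj -/bc.
clear cc qs; clearbody bj bc br bl.
by case: bj; case: bc; case: br; case: bl.
Qed.

End Family.

(** * Rational parameters for each count *)

(** Stated over any ordered field, so that it can be evaluated on rational numbers and
   transferred to R. *)
Definition admissible (F : realFieldType) (eps m n e : F) : bool :=
  let g := n + m + e - n * e in let k := 1 + m - e in
  [&& eps ^+ 2 - 1 == 0,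
      all (fun x => x != 0) [:: m; n; e; m - 1; n - 1; m - e; m - n; 1 - m - e;
        m - n + n * e; g ^+ 2 - 4%:R * m * n] &
      all (fun x => x != 0) [:: 4%:R * m - 2%:R * g + n;
        4%:R * m - 2%:R * g * k + n * k ^+ 2; 1 - e]].

Definition real_count (F : realFieldType) (eps m n e : F) : nat :=
  let g := n + m + e - n * e in
  (3 * (0 < eps)%R + 2 * (0 < eps * (m * (1 - e)) * (e * (1 - m)))%R +
   4 * ((0 < eps) && (0 < g ^+ 2 - 4%:R * m * n))%R +
   ((0 < eps * m * (m - n)) && (0 < eps * (1 - n) * m * (m - n + n * e)))%R)%N.

Lemma family_exists (R : realType) (eps m n e : R) : admissible eps m n e ->
  exists C1 C2 : set (proj_point R),
    [/\ twisted_cubic C1 /\ real_locus C1,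
        twisted_cubic C2 /\ real_locus C2,
        [set l | common_secant C1 C2 l] #= `I_10 &
        [set l | totally_real C1 C2 l] #= `I_(real_count eps m n e)].
Proof.
rewrite /admissible /= !andbT => /and3P[/eqP/subr0_eq eps2].
move=> /and5P[m0 n0 e0 m1 /and5P[n1 me mn l0 /andP[mne disc0]]] /and3P[tan1 tan2 e1].
rewrite !subr_eq0 in m1 n1 me mn; rewrite subr_eq0 eq_sym in e1.
have h2 := sqrtCK (real_complex R eps).
have A1 : (1%:M : 'M[R]_4) \in unitmx := unitmx1 _ _.
have A2 := second_mx_unit eps2 n1 l0.
have [common real] :=
  family_counts eps2 h2 n1 l0 m0 e0 n0 m1 e1 me mn mne disc0 tan1 tan2.
exists (curve (map_mx (real_complex R) (1%:M : 'M[R]_4))),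
       (curve (map_mx (real_complex R) (second_mx m n e eps))); split=> //.
- split; last exact: real_locus_curve A1.
  by apply: twisted_cubic_curve; rewrite map_unitmx.
- split; last exact: real_locus_curve A2.
  by apply: twisted_cubic_curve; rewrite map_unitmx.
Qed.

Section Rational.
Variables (F : realFieldType) (eps m n e : rat).
Let r : rat -> F := ratr.

Lemma admissible_ratr : admissible (r eps) (r m) (r n) (r e) = admissible eps m n e.
Proof.
rewrite /admissible /= -!(fmorph_eq0 (ratr : {rmorphism rat -> F})).
by rewrite !(rmorphD, rmorphB, rmorphM, rmorphXn, rmorph_nat, rmorph1, rmorphN).
Qed.

Lemma real_count_ratr : real_count (r eps) (r m) (r n) (r e) = real_count eps m n e.
Proof.
rewrite /real_count -!(ltr0q F).
by rewrite !(rmorphD, rmorphB, rmorphM, rmorphXn, rmorph_nat, rmorph1, rmorphN).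
Qed.

End Rational.

(** The entry of index k is a quadruple (eps, m, n, e) with k totally real secants. *)
Definition instances : seq (rat * rat * rat * rat) :=
  [:: (-1, -1, 2%:R, -2%:R); (-1, -1, -2%:R, -2%:R); (-1, 2%:R^-1, -1, -1);
      (1, -1, -3%:R, 2%:R^-1); (1, -2%:R, -1, 2%:R^-1); (1, -2%:R, -3%:R, 2%:R);
      (1, -2%:R, -1, 2%:R); (1, -1, 2%:R, 2%:R^-1); (1, 2%:R^-1, -1, -1);
      (1, -1, 2%:R, -2%:R); (1, 2%:R, -1, -2%:R)].

Lemma instances_spec (k : nat) : (k <= 10)%N ->
  exists eps m n e : rat, admissible eps m n e /\ real_count eps m n e = k.
Proof.
pose spec (i : nat) (t : rat * rat * rat * rat) :=
  let: (eps, m, n, e) := t in admissible eps m n e && (real_count eps m n e == i).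
have check : all (fun i => spec i (nth (1, 0, 0, 0) instances i)) (iota 0 11).
  by vm_compute.
move=> hk; have kin : k \in iota 0 11 by rewrite mem_iota.
have := allP check k kin; move: (nth _ _ k) => [[[eps m] n] e].
by move=> /andP[adm /eqP cnt]; exists eps, m, n, e; split; [exact: adm|exact: cnt].
Qed.

Theorem theorem1p6 (R : realType) (k : nat) (hk : (k <= 10)%N) :
  exists C1 C2 : set (proj_point R),
    [/\ twisted_cubic C1 /\ real_locus C1,
        twisted_cubic C2 /\ real_locus C2,
        [set l | common_secant C1 C2 l] #= `I_10 &
        [set l | totally_real C1 C2 l] #= `I_k].
Proof.
have [eps [m [n [e [adm <-]]]]] := instances_spec hk.
by rewrite -(real_count_ratr R); apply: family_exists; rewrite admissible_ratr.
Qed.
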